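(* For every fixed degree $d$, there is an algorithm, running in time $O(n^{d+1})$, that decides whether a given homogeneous polynomial $f\in\mathbb{R}[z_1,\dots,z_n]$ of degree $d$ with nonnegative coefficients is completely log concave on $\mathbb{R}^n_{\geq 0}$.
   Context: A polynomial $g$ with nonnegative coefficients is log concave if $\log(g)$ is a concave function on $\mathbb{R}^n_{>0}$ (with $\log 0=-\infty$, so that the zero polynomial counts as log concave). A polynomial $g\in\mathbb{R}[z_1,\dots,z_n]$ is completely log concave if for every $k\geq 0$ and every entrywise nonnegative matrix $V\in\mathbb{R}^{n\times k}_{\geq 0}$, the polynomial $D_Vg(z)=\left(\prod_{j=1}^k\sum_{i=1}^n V_{ij}\frac{\partial}{\partial z_i}\right)g(z)$ is nonnegative and log concave as a function on $\mathbb{R}^n_{>0}$. The degree $d$ is fixed, so the constant in $O(n^{d+1})$ may depend on $d$; the polynomial is given by the list of its coefficients, and running time counts arithmetic operations and comparisons on real numbers. *)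

(* Defs.v *)
From HB Require Import structures.
From mathcomp Require Import all_boot all_order all_algebra.
From mathcomp Require Import reals.
From mathcomp Require constructive_ereal exp.
From mathcomp Require mpoly.

Set Implicit Arguments.
Unset Strict Implicit.
Unset Printing Implicit Defensive.

Import Order.TTheory GRing.Theory Num.Theory.
Local Open Scope ring_scope.

(* The notations of multinomials and of mathcomp-analysis cannot be imported
   together, so each is imported inside its own module. *)

Module Export LogConcave.
Import constructive_ereal exp.

Definition positive (R : realType) (n : nat) (x : 'I_n -> R) : Prop :=
  forall i, 0 < x i.

(* [lne] is the extended-real logarithm, equal to -oo at 0 (and at negative
   numbers, which is harmless: below, log-concavity always comes with
   nonnegativity). *)
Definition log_concave (R : realType) (n : nat) (g : ('I_n -> R) -> R) : Prop :=
  forall (x y : 'I_n -> R) (t : R),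
    positive x -> positive y -> 0 < t < 1 ->
    (t%:E * lne (g x)%:E + (1 - t)%:E * lne (g y)%:E
       <= lne (g (fun i => t * x i + (1 - t) * y i)%R)%:E)%E.

End LogConcave.

Module Export Polynomials.
Import mpoly.

Definition D_mx (R : realType) (n k : nat) (V : 'M[R]_(n, k))
    (g : {mpoly R[n]}) : {mpoly R[n]} :=
  foldr (fun j p => \sum_(i < n) V i j *: mderiv i p) g (enum 'I_k).

Definition completely_log_concave (R : realType) (n : nat)
    (g : {mpoly R[n]}) : Prop :=
  forall (k : nat) (V : 'M[R]_(n, k)), (forall i j, 0 <= V i j) ->
    (forall x : 'I_n -> R, positive x -> 0 <= meval x (D_mx V g))
    /\ log_concave (fun x : 'I_n -> R => meval x (D_mx V g)).

(* The sequences i_1 <= ... <= i_d of indices below n, in lexicographic order;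
   they enumerate the monomials z_{i_1} ... z_{i_d} of degree d. *)
Fixpoint monomial_words (n d : nat) : seq (seq 'I_n) :=
  if d is d'.+1 then
    [seq i :: w | i : 'I_n <- enum 'I_n,
                  w : seq 'I_n <- [seq w <- monomial_words n d' |
                         all (fun j : 'I_n => (i <= j)%N) w]]
  else [:: [::]].

Definition coeff_list (R : realType) (n d : nat) (f : {mpoly R[n]}) : seq R :=
  [seq f@_(s2m w) | w <- monomial_words n d].

End Polynomials.

(* A real random access machine, presented as a structured language. The memory
   consists of named arrays of unbounded length, some holding natural numbers
   (counters and addresses) and some holding real numbers; a scalar variable is
   cell 0 of an array. Real numbers influence natural numbers only through
   comparisons, and the only real constants of a program are integers. *)

Inductive nexpr : Type :=
| NConst of nat
| NGet of nat & nexpr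
| NAdd of nexpr & nexpr
| NSub of nexpr & nexpr
| NMul of nexpr & nexpr.

Inductive rexpr : Type :=
| RConst of int
| RGet of nat & nexpr
| RAdd of rexpr & rexpr
| RSub of rexpr & rexpr
| RMul of rexpr & rexpr
| RDiv of rexpr & rexpr.

Inductive bexpr : Type :=
| BNle of nexpr & nexpr
| BRle of rexpr & rexpr
| BNot of bexpr
| BAnd of bexpr & bexpr.

(* [NSet a e v] and [RSet a e v] store v in cell e of array a. *)
Inductive cmd : Type :=
| Skip
| NSet of nat & nexpr & nexpr
| RSet of nat & nexpr & rexpr
| Seq of cmd & cmd
| If of bexpr & cmd & cmd
| While of bexpr & cmd.

Record state (R : realType) : Type := State {
  nats : nat -> nat -> nat;
  rels : nat -> nat -> R
}.

Definition update (T : Type) (m : nat -> nat -> T) (a i : nat) (v : T) :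
    nat -> nat -> T :=
  fun b j => if (b == a) && (j == i) then v else m b j.

Fixpoint neval (R : realType) (s : state R) (e : nexpr) : nat :=
  match e with
  | NConst c => c
  | NGet a e1 => nats s a (neval s e1)
  | NAdd e1 e2 => (neval s e1 + neval s e2)%N
  | NSub e1 e2 => (neval s e1 - neval s e2)%N
  | NMul e1 e2 => (neval s e1 * neval s e2)%N
  end.

(* Division is total, with x / 0 = 0. *)
Fixpoint reval (R : realType) (s : state R) (e : rexpr) : R :=
  match e with
  | RConst c => c%:~R
  | RGet a e1 => rels s a (neval s e1)
  | RAdd e1 e2 => reval s e1 + reval s e2
  | RSub e1 e2 => reval s e1 - reval s e2
  | RMul e1 e2 => reval s e1 * reval s e2
  | RDiv e1 e2 => reval s e1 / reval s e2
  end.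

Fixpoint beval (R : realType) (s : state R) (e : bexpr) : bool :=
  match e with
  | BNle e1 e2 => (neval s e1 <= neval s e2)%N
  | BRle e1 e2 => reval s e1 <= reval s e2
  | BNot e1 => ~~ beval s e1
  | BAnd e1 e2 => beval s e1 && beval s e2
  end.

(* Every memory access, arithmetic operation, comparison, constant and Boolean
   connective costs one unit, on natural numbers as well as on real numbers. *)
Fixpoint ncost (e : nexpr) : nat :=
  match e with
  | NConst _ => 1
  | NGet _ e1 => (ncost e1).+1
  | NAdd e1 e2 | NSub e1 e2 | NMul e1 e2 => (ncost e1 + ncost e2).+1
  end.

Fixpoint rcost (e : rexpr) : nat :=
  match e with
  | RConst _ => 1
  | RGet _ e1 => (ncost e1).+1
  | RAdd e1 e2 | RSub e1 e2 | RMul e1 e2 | RDiv e1 e2 =>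
      (rcost e1 + rcost e2).+1
  end.

Fixpoint bcost (e : bexpr) : nat :=
  match e with
  | BNle e1 e2 => (ncost e1 + ncost e2).+1
  | BRle e1 e2 => (rcost e1 + rcost e2).+1
  | BNot e1 => (bcost e1).+1
  | BAnd e1 e2 => (bcost e1 + bcost e2).+1
  end.

(* [exec c s t s'] : started in state s, the command c halts in state s' after
   time t. *)
Inductive exec (R : realType) : cmd -> state R -> nat -> state R -> Prop :=
| exec_skip s : exec Skip s 1 s
| exec_nset a e v s :
    exec (NSet a e v) s (ncost e + ncost v).+1
      (State (update (nats s) a (neval s e) (neval s v)) (rels s))
| exec_rset a e v s :
    exec (RSet a e v) s (ncost e + rcost v).+1
      (State (nats s) (update (rels s) a (neval s e) (reval s v)))
| exec_seq c1 c2 s t1 s1 t2 s2 :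
    exec c1 s t1 s1 -> exec c2 s1 t2 s2 -> exec (Seq c1 c2) s (t1 + t2) s2
| exec_if b c1 c2 s t s1 :
    exec (if beval s b then c1 else c2) s t s1 ->
    exec (If b c1 c2) s (bcost b + t).+1 s1
| exec_while_stop b c s :
    beval s b = false -> exec (While b c) s (bcost b).+1 s
| exec_while_loop b c s t1 s1 t2 s2 :
    beval s b = true -> exec c s t1 s1 -> exec (While b c) s1 t2 s2 ->
    exec (While b c) s (bcost b + t1 + t2).+1 s2.

Lemma exec_det (R : realType) (c : cmd) (s : state R) (t1 t2 : nat)
    (s1 s2 : state R) :
  exec c s t1 s1 -> exec c s t2 s2 -> t1 = t2 /\ s1 = s2.
Proof.
move=> E1; elim: E1 t2 s2 => {c s t1 s1}.
- by move=> s t2 s2 E; inversion E.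
- by move=> a e v s t2 s2 E; inversion E.
- by move=> a e v s t2 s2 E; inversion E.
- move=> c1 c2 s t1 s1 t2 s2 _ IH1 _ IH2 t s' E.
  inversion E as [| | |? ? ? ? ? ? ? E1 E2| | |]; subst.
  by case: (IH1 _ _ E1) => ? ?; subst; case: (IH2 _ _ E2) => -> ->.
- move=> b c1 c2 s t s1 _ IH t2 s2 E.
  inversion E as [| | | |? ? ? ? ? ? E1| |]; subst.
  by case: (IH _ _ E1) => -> ->.
- move=> b c s Hb t2 s2 E.
  by inversion E; subst; split; congruence.
- move=> b c s t1 s1 t2 s2 Hb _ IH1 _ IH2 t s' E.
  inversion E as [| | | | | |? ? ? ? ? ? ? ? E1 E2]; subst; first by congruence.
  by case: (IH1 _ _ E1) => ? ?; subst; case: (IH2 _ _ E2) => -> ->.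
Qed.

(* The input is the number n of variables, in cell 0 of natural array 0, and
   the list of coefficients, in real array 0; every other cell holds 0. *)
Definition input (R : realType) (n : nat) (cs : seq R) : state R :=
  State (update (fun _ _ => 0%N) 0 0 n)
        (fun a i => if a == 0%N then nth 0 cs i else 0).

Definition accepts (R : realType) (s : state R) : Prop := nats s 0 0 <> 0%N.

(* Main.v *)
Require Import Defs.
From mathcomp Require Import all_boot all_order all_algebra.
From mathcomp Require Import reals zify ring lra.
From mathcomp Require boolp constructive_ereal sequences exp.

(* For d >= 2 and a word w of at most d - 2 indices, let Q_w be the Hessian of
   the derivative of f along w at the all-ones vector 1.  Then f is completely
   log concave iff every Q_w is Lorentzian: y^T Q_w y <= 0 whenever
   1^T Q_w y = 0.

   Necessity is the second order condition for log-concavity at 1.  For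
   sufficiency, encode f as a symmetric d-linear form F; it is enough to show
   that F(v_1, ..., v_{d-2}, ., .) is Lorentzian for all positive v_i.  This goes
   by induction on the number of vectors plugged in, by a trickling-down
   argument which needs the graph of nonzero entries to be connected; this graph
   does not depend on the v_i, so connectedness can be read off at 1.  Log-concavity
   of g(z) = F(v_1, ..., v_k, z, ..., z) follows by expanding
   F(.., (t x + (1 - t) y)^m) binomially, since a |-> F(.., x^a, y^(m - a)) is a
   log-concave sequence.

   Q_w is Lorentzian iff (Q_w 1) (Q_w 1)^T - (1^T Q_w 1) Q_w is positive
   semidefinite, which symmetric elimination without pivoting decides in O(n^3)
   operations.  The entries of all Q_w are sums of the d-th derivatives of f, and
   there are O(n^(d-2)) words w. *)

Set Implicit Arguments.
Unset Strict Implicit.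
Unset Printing Implicit Defensive.

Import Order.TTheory GRing.Theory Num.Theory.
Local Open Scope ring_scope.

(** * Lorentzian quadratic forms *)

(** The vectors plugged into the form are of three kinds, and this shapes the argument. The test
    sees only coordinate vectors and [1]. Trickling down works at positive vectors, because it
    rescales by them. Complete log-concavity involves columns that may have zero entries, and these
    are reached by a perturbation tending to 0. Eigenvalues are avoided: a Lorentzian form is used
    only through the reversed Cauchy inequality, so the theory of forms holds over any real field
    and its limits are elementary.

    The convention [x / 0 = 0] absorbs zero rows, in the trickling argument as well as in the
    elimination.

    The input has one coefficient per monomial, while the test needs the form on all [n ^ d] words.
    A constant amount of work per word must therefore find the right coefficient and its
    multiplicity, which is why words are visited in lexicographic order. *)

Lemma sum_ge0_eq0 (R : numDomainType) (I : finType) (F : I -> R) :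
  (forall i, 0 <= F i) -> \sum_i F i = 0 -> forall i, F i = 0.
Proof. by move=> F0 /psumr_eq0P s0 i; apply: s0. Qed.

Lemma sum2_ge0_eq0 (R : numDomainType) (I J : finType) (F : I -> J -> R) :
  (forall i j, 0 <= F i j) -> \sum_i \sum_j F i j = 0 -> forall i j, F i j = 0.
Proof.
move=> F0 s0 i; apply: sum_ge0_eq0 => //.
by move: i; apply: sum_ge0_eq0 => // i; apply: sumr_ge0.
Qed.

Section Forms.
Variables (R : realFieldType) (n : nat).
Implicit Types (H : 'I_n -> 'I_n -> R) (x y u p : 'I_n -> R).

Definition bil H x y : R := \sum_i \sum_j H i j * (x i * y j).

Definition sym2 H := forall i j, H i j = H j i.

(** For a symmetric [H] with [bil H p p > 0] this says that [H] has exactly one positive eigenvalue,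
    in a form that avoids eigenvalues. *)
Definition lorentz H p := forall y, bil H p y = 0 -> bil H y y <= 0.

Definition psd H := forall x, 0 <= bil H x x.

(* The graph of nonzero entries is connected off the zero rows. *)
Definition conn H := forall u, (forall i j, H i j != 0 -> u i = u j) ->
  exists c, forall i j, H i j != 0 -> u i = c.

Lemma eq_bil H x x' y y' : x =1 x' -> y =1 y' -> bil H x y = bil H x' y'.
Proof. by move=> ex ey; apply: eq_bigr => i _; apply: eq_bigr => j _; rewrite ex ey. Qed.

Lemma bilC H x y : sym2 H -> bil H x y = bil H y x.
Proof.
move=> sH; rewrite /bil exchange_big; apply: eq_bigr => i _; apply: eq_bigr => j _.
by rewrite sH [y i * _]mulrC.
Qed.

Lemma bil_combr H x y z (s t : R) :
  bil H x (fun i => s * y i + t * z i) = s * bil H x y + t * bil H x z.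
Proof.
rewrite /bil !mulr_sumr -big_split /=; apply: eq_bigr => i _.
rewrite !mulr_sumr -big_split /=; apply: eq_bigr => j _; ring.
Qed.

Lemma bil_comb2 H x y (s t : R) : sym2 H ->
  bil H (fun i => s * x i + t * y i) (fun i => s * x i + t * y i) =
  s ^+ 2 * bil H x x + 2 * (s * t) * bil H x y + t ^+ 2 * bil H y y.
Proof.
move=> sH; rewrite bil_combr (bilC _ x sH) (bilC _ y sH) !bil_combr (bilC y x sH); ring.
Qed.

Lemma psd_cauchy H x y : sym2 H -> psd H -> bil H x y ^+ 2 <= bil H x x * bil H y y.
Proof.
move=> sH pH.
have px := pH x; have py := pH y.
have Q s t := bil_comb2 x y s t sH.
(* With [a], [b], [c] the values at [(x, x)], [(x, y)], [(y, y)], the test vector [c x - b y] gives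
   [c (a c - b^2) >= 0], and [b x - (a + 1) y] forces [b = 0] when [c = 0]. *)
have Q1 : 0 <= bil H y y ^+ 2 * bil H x x + 2 * (bil H y y * - bil H x y) * bil H x y
   + (- bil H x y) ^+ 2 * bil H y y by rewrite -Q; apply: pH.
have Q2 : 0 <= bil H x y ^+ 2 * bil H x x
   + 2 * (bil H x y * - (bil H x x + 1)) * bil H x y
   + (- (bil H x x + 1)) ^+ 2 * bil H y y by rewrite -Q; apply: pH.
move: Q1 Q2; set a := bil H x x in px *; set b := bil H x y; set c := bil H y y in py *.
move=> Q1 Q2; have [c0|c0] := eqVneq c 0.
  rewrite c0 mulr0 !mulr0 addr0 in Q2 *; nra.
have {c0}c0 : 0 < c by rewrite lt_neqAle eq_sym c0.
rewrite -subr_ge0 -(pmulr_rge0 _ c0); nra.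
Qed.

(** If [u.Hu > 0], a vector of positive square orthogonal to [u] would span with [u] a positive
    definite plane, but every plane meets the hyperplane orthogonal to [p]. The inequality thus
    holds at any [u] of nonnegative square, whatever the witness [p]. *)
Lemma lorentz_cauchy H p u y : sym2 H -> lorentz H p -> 0 <= bil H u u ->
  bil H u u * bil H y y <= bil H u y ^+ 2.
Proof.
move=> sH L uu0.
have [uu|uu] := eqVneq (bil H u u) 0; first by rewrite uu mul0r sqr_ge0.
have {uu0 uu}uu : 0 < bil H u u by rewrite lt_neqAle eq_sym uu.
pose y' i := bil H u u * y i + - bil H u y * u i.
have uy' : bil H u y' = 0 by rewrite bil_combr; ring.
have yy' : bil H y' y' = bil H u u * (bil H u u * bil H y y - bil H u y ^+ 2).
  by rewrite bil_comb2 // (bilC y u) //; ring.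
have y'0 : bil H y' y' <= 0.
  rewrite leNgt; apply/negP => y'0.
  (* The combination of [u] and [y'] orthogonal to [p]. Its square is nonpositive only if both
     coefficients vanish, and then [u] itself is orthogonal to [p]. *)
  pose z i := bil H p y' * u i + - bil H p u * y' i.
  have pz : bil H p z = 0 by rewrite bil_combr; ring.
  have := L z pz; rewrite bil_comb2 // uy' mulr0 addr0 sqrrN => zz.
  have pu0 : bil H p u ^+ 2 = 0.
    have := sqr_ge0 (bil H p u); have := sqr_ge0 (bil H p y'); nra.
  move/eqP: pu0; rewrite sqrf_eq0 => /eqP /L; lra.
by rewrite yy' pmulr_rle0 // subr_le0 in y'0.
Qed.

(** The quadratic form of this matrix is [(p.Hx)^2 - (p.Hp)(x.Hx)], so semidefiniteness is the
    reversed Cauchy inequality at [p]; on the hyperplane [p.Hx = 0] it gives [lorentz] back. *)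
Lemma lorentz_psd H p : sym2 H -> bil H p p != 0 -> 0 <= bil H p p ->
  lorentz H p <->
  psd (fun i j => (\sum_k H i k * p k) * (\sum_k H j k * p k) - bil H p p * H i j).
Proof.
move=> sH p0 pge.
have E x : bil (fun i j => (\sum_k H i k * p k) * (\sum_k H j k * p k) - bil H p p * H i j) x x
   = bil H p x ^+ 2 - bil H p p * bil H x x.
  have hx : bil H p x = \sum_i x i * \sum_k H i k * p k.
    rewrite bilC // /bil; apply: eq_bigr => i _; rewrite mulr_sumr; apply: eq_bigr => j _; ring.
  rewrite [in RHS]hx expr2 mulr_suml {2}/bil mulr_sumr -sumrB.
  apply: eq_bigr => i _; rewrite -mulrA mulr_sumr !mulr_sumr -sumrB /bil.
  apply: eq_bigr => j _; ring.
split=> [L x|P y py].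
  by rewrite E subr_ge0; apply: (lorentz_cauchy _ sH L).
have := P y; rewrite E py expr0n /= sub0r oppr_ge0 pmulr_rle0 //.
by rewrite lt_neqAle eq_sym p0.
Qed.

(** Fredholm alternative: the columns of the cokernel of [G] are kernel vectors, so [b] annihilates
    them and lies in the row space; symmetry turns the row combination into a solution. *)
Lemma sym_solve H (b : 'I_n -> R) : sym2 H ->
  (forall z, (forall i, \sum_j H i j * z j = 0) -> \sum_i b i * z i = 0) ->
  exists z, forall i, \sum_j H i j * z j = b i.
Proof.
move=> sH hb.
pose G := \matrix_(i, j) H i j; pose v := \row_i b i.
have /submxP[w vw] : (v <= G)%MS.
  rewrite submxE; apply/eqP/rowP => k; rewrite !mxE.
  transitivity (\sum_i b i * cokermx G i k); first by apply: eq_bigr => i _; rewrite !mxE.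
  apply: hb => i; have /matrixP/(_ i k) := mulmx_coker G; rewrite !mxE => E.
  by rewrite -[RHS]E; apply: eq_bigr => j _; rewrite !mxE.
exists (w 0) => i; have /rowP/(_ i) := vw; rewrite !mxE => ->.
by apply: eq_bigr => j _; rewrite !mxE sH mulrC.
Qed.

(** Two components would give two independent positive directions. Concretely, a function constant
    along edges, centred by its mean weighted with the row sums, is orthogonal to [1]; its square is
    then a sum of nonnegative terms that must all vanish. *)
Lemma lorentz_conn H : sym2 H -> (forall i j, 0 <= H i j) ->
  lorentz H (fun=> 1) -> conn H.
Proof.
move=> sH H0 L u hu.
pose k i := \sum_j H i j.
have k0 i : 0 <= k i by apply: sumr_ge0.
have [s0|s0] := eqVneq (\sum_i k i) 0.
  exists 0 => i j; rewrite (_ : H i j = 0) ?eqxx //.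
  exact: (sum2_ge0_eq0 H0 s0).
pose c := (\sum_i k i * u i) / \sum_i k i; exists c.
pose v i := u i - c.
have v1 : bil H (fun=> 1) v = 0.
  transitivity (\sum_i (k i * u i - c * k i)).
    rewrite bilC //; apply: eq_bigr => i _; rewrite /k mulr_suml mulr_sumr -sumrB.
    apply: eq_bigr => j _; rewrite /v; ring.
  by rewrite sumrB -mulr_sumr /c divfK // subrr.
have v2 : bil H v v = \sum_i \sum_j H i j * v i ^+ 2.
  apply: eq_bigr => i _; apply: eq_bigr => j _.
  have [->|hij] := eqVneq (H i j) 0; first by rewrite !mul0r.
  by rewrite /v (hu _ _ hij) expr2.
have P i j : 0 <= H i j * v i ^+ 2 by rewrite mulr_ge0 ?sqr_ge0.
have P' i : 0 <= \sum_j H i j * v i ^+ 2 by apply: sumr_ge0.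
have : \sum_i \sum_j H i j * v i ^+ 2 = 0.
  apply/eqP; rewrite eq_le -{1}v2 L //=; exact: sumr_ge0.
move=> /(sum2_ge0_eq0 P) Z i j hij; have /eqP := Z i j.
by rewrite mulf_eq0 (negPf hij) /= sqrf_eq0 subr_eq0 => /eqP.
Qed.

(* Trickling down at the all-ones vector.  With D the diagonal of the row sums
   and G = D - K (a graph Laplacian, psd), the hypothesis says K <= K D^-1 K,
   that is G <= G D^-1 G.  For u orthogonal to ker D - K, solve G z = D u; then
   (u.Du)^2 = (u.Gz)^2 <= (u.Gu)(z.Gz) <= (u.Gu)(u.Du), so u.Ku <= 0. *)
Lemma trickle (K : 'I_n -> 'I_n -> R) :
  let k i := \sum_j K i j in
  sym2 K -> (forall i j, 0 <= K i j) -> conn K ->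
  (forall u, bil K u u <= \sum_i (\sum_j K i j * u j) ^+ 2 / k i) ->
  lorentz K (fun=> 1).
Proof.
move=> k sK K0 cK T u u1.
pose G i j := k i *+ (i == j) - K i j.
have Gv v i : \sum_j G i j * v j = k i * v i - \sum_j K i j * v j.
  rewrite -[k i * v i](_ : \sum_j (k i *+ (i == j)) * v j = _) -?sumrB.
    by apply: eq_bigr => j _; rewrite /G mulrBl.
  rewrite (bigD1 i) //= eqxx big1 ?addr0 // => j ji.
  by rewrite eq_sym (negPf ji) mul0r.
have bG v w : bil G v w = \sum_i v i * (k i * w i - \sum_j K i j * w j).
  apply: eq_bigr => i _; rewrite -Gv mulr_sumr; apply: eq_bigr => j _; ring.
have sG : sym2 G.
  move=> i j; rewrite /G sK eq_sym; congr (_ - _).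
  by have [->|] := eqVneq j i; rewrite ?mulr0n.
have E v : bil G v v *+ 2 = \sum_i \sum_j K i j * (v i - v j) ^+ 2.
  have e1 : bil G v v = \sum_i \sum_j K i j * (v i ^+ 2 - v i * v j).
    rewrite bG; apply: eq_bigr => i _; rewrite mulrBr /k mulr_suml !mulr_sumr -sumrB.
    apply: eq_bigr => j _; ring.
  have e2 : bil G v v = \sum_i \sum_j K i j * (v j ^+ 2 - v i * v j).
    rewrite e1 exchange_big; apply: eq_bigr => i _; apply: eq_bigr => j _.
    by rewrite sK; ring.
  rewrite mulr2n {1}e1 e2 -big_split; apply: eq_bigr => i _.
  rewrite -big_split; apply: eq_bigr => j _ /=; ring.
have PK v i j : 0 <= K i j * (v i - v j) ^+ 2 by rewrite mulr_ge0 ?sqr_ge0.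
have pG : psd G.
  move=> v; rewrite -(pmulrn_lge0 _ (isT : 0 < 2)%N) E.
  by apply: sumr_ge0 => i _; apply: sumr_ge0.
have ku : \sum_i k i * u i = 0.
  rewrite -[RHS]u1 bilC //; apply: eq_bigr => i _; rewrite mulr_suml.
  by apply: eq_bigr => j _; rewrite mulr1.
have [z Gz] : exists z, forall i, \sum_j G i j * z j = k i * u i.
  apply: sym_solve => // z z0.
  have Gzz : bil G z z *+ 2 = 0.
    rewrite (_ : bil G z z = 0) ?mul0rn //; apply: big1 => i _.
    transitivity (z i * \sum_j G i j * z j); last by rewrite z0 mulr0.
    by rewrite mulr_sumr; apply: eq_bigr => j _; ring.
  (* So [z] is constant along edges, hence equal to a single [c] wherever the row sum is nonzero;
     the remaining rows contribute nothing to the pairing with [D u]. *)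
  have Ez i j : K i j * (z i - z j) ^+ 2 = 0.
    by move: Gzz; rewrite E => /(sum2_ge0_eq0 (PK z)).
  have [i j Kij|c zc] := cK z.
    by move/eqP: (Ez i j); rewrite mulf_eq0 (negPf Kij) sqrf_eq0 subr_eq0 => /eqP.
  transitivity (\sum_i c * (k i * u i)); last by rewrite -mulr_sumr ku mulr0.
  apply: eq_bigr => i _; have [k0|] := eqVneq (k i) 0; first by rewrite k0 !mul0r mulr0.
  rewrite psumr_neq0 // => /hasP[j _ /andP[_ /lt0r_neq0 Kij]].
  by rewrite (zc i j) // mulrC.
have Kz i : \sum_j K i j * z j = k i * (z i - u i).
  by rewrite mulrBr -(Gz i) Gv; ring.
have aE : bil G u z = \sum_i k i * u i ^+ 2.
  rewrite bG; apply: eq_bigr => i _; rewrite Kz; ring.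
have bE : bil G z z = \sum_i k i * (z i * u i).
  rewrite bG; apply: eq_bigr => i _; rewrite Kz; ring.
have cE : bil G u u = bil G u z - bil K u u.
  rewrite aE bG /bil -sumrB; apply: eq_bigr => i _.
  rewrite mulrBr mulr_sumr; congr (_ - _); first ring.
  by apply: eq_bigr => j _; ring.
have ba : bil G z z <= bil G u z.
  have := T z; rewrite aE bE -subr_ge0 => Tz; rewrite -subr_ge0; move: Tz; rewrite /bil -!sumrB.
  move=> /le_trans; apply; apply: ler_sum => i _.
  rewrite Kz (_ : \sum_j _ = z i * (k i * (z i - u i))); last first.
    by rewrite -Kz mulr_sumr; apply: eq_bigr => j _; ring.
  have [->|ki] := eqVneq (k i) 0; first by rewrite !mul0r expr0n /= mul0r mulr0.
  by rewrite le_eqVlt; apply/orP; left; apply/eqP; field.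
have := psd_cauchy u z sG pG; have := pG u; have := pG z.
move: ba; rewrite cE; move: (bil G u z) (bil G z z) (bil K u u) => a b q.
by move=> ba b0 c0 ac; nra.
Qed.

Lemma conn_supp H H' : (forall i j, (H i j != 0) = (H' i j != 0)) -> conn H -> conn H'.
Proof.
move=> E C u hu; have [i j|c hc] := C u; first by rewrite E; apply: hu.
by exists c => i j; rewrite -E; apply: hc.
Qed.

Lemma bil_scale H (x y v : 'I_n -> R) :
  bil (fun i j => H i j * (v i * v j)) x y = bil H (fun i => v i * x i) (fun i => v i * y i).
Proof. by apply: eq_bigr => i _; apply: eq_bigr => j _; ring. Qed.

(** Rescaling by [v] turns [v] into the all-ones vector, with row sums [v i * bil (E i) v v]. By
    symmetry [bil H z z] is the sum of the [v i * bil (E i) z z], so the reversed Cauchy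
    inequalities of the slices add up to the hypothesis of [trickle]. *)
Lemma tensor_step (E : 'I_n -> 'I_n -> 'I_n -> R) (v : 'I_n -> R) :
  let H j k := \sum_i v i * E i j k in
  (forall i j k, E i j k = E j i k) -> (forall i j k, E i j k = E i k j) ->
  (forall i j k, 0 <= E i j k) -> (forall i, 0 < v i) ->
  (forall i y, bil (E i) v v * bil (E i) y y <= bil (E i) v y ^+ 2) ->
  conn H -> lorentz H v.
Proof.
move=> H E1 E2 E0 v0 L cH y vy.
have sH : sym2 H by move=> i j; apply: eq_bigr => k _; rewrite E2.
have H0 i j : 0 <= H i j by apply: sumr_ge0 => k _; rewrite mulr_ge0 ?E0 ?ltW.
have v_ne i : v i != 0 by rewrite gt_eqF.
have HE i w : \sum_k H i k * w k = bil (E i) v w.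
  rewrite /bil exchange_big; apply: eq_bigr => k _; rewrite /H mulr_suml.
  by apply: eq_bigr => j _; rewrite E1; ring.
pose K i j := H i j * (v i * v j).
have KL : lorentz K (fun=> 1).
  apply: trickle => [i j|i j||w].
  - by rewrite /K sH; ring.
  - by rewrite /K mulr_ge0 // mulr_ge0 // ltW.
  - by apply: conn_supp cH => i j; rewrite /K !mulf_eq0 !(negPf (v_ne _)) !orbF.
  - pose z i := v i * w i.
    have Kw i : \sum_j K i j * w j = v i * bil (E i) v z.
      by rewrite -HE mulr_sumr; apply: eq_bigr => j _; rewrite /K /z; ring.
    have K1 i : \sum_j K i j = v i * bil (E i) v v.
      by rewrite -HE mulr_sumr; apply: eq_bigr => j _; rewrite /K; ring.
    rewrite bil_scale -/z.
    have -> : bil H z z = \sum_i v i * bil (E i) z z.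
      transitivity (\sum_j \sum_k \sum_i v i * (E i j k * (z j * z k))).
        apply: eq_bigr => j _; apply: eq_bigr => k _; rewrite mulr_suml.
        by apply: eq_bigr => i _; ring.
      rewrite (eq_bigr _ (fun j _ => exchange_big _ _ _ _ _ _)) /= exchange_big /=.
      apply: eq_bigr => i _; rewrite /bil mulr_sumr; apply: eq_bigr => j _.
      by rewrite mulr_sumr.
    apply: ler_sum => i _; rewrite Kw K1.
    (* A nonnegative slice with [bil (E i) v v = 0] is zero, so the quotient by a zero row sum loses
       nothing. *)
    have [vv|vv] := eqVneq (bil (E i) v v) 0.
      have Ez j k : E i j k = 0.
        have P a b : 0 <= E i a b * (v a * v b) by rewrite mulr_ge0 // mulr_ge0 // ltW.
        have /eqP := sum2_ge0_eq0 P vv j k.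
        by rewrite !mulf_eq0 !(negPf (v_ne _)) !orbF => /eqP.
      have -> : bil (E i) z z = 0.
        by apply: big1 => j _; apply: big1 => k _; rewrite Ez mul0r.
      by rewrite vv !mulr0 invr0 mulr0.
    have vp : 0 < bil (E i) v v.
      rewrite lt_neqAle eq_sym vv; apply: sumr_ge0 => a _; apply: sumr_ge0 => b _.
      by rewrite mulr_ge0 // mulr_ge0 // ltW.
    rewrite ler_pdivlMr ?mulr_gt0 //; have := L i z; have := v0 i.
    move: (bil (E i) v v) (bil (E i) z z) (bil (E i) v z) (v i) => a b c t t0 abc.
    have -> : (t * c) ^+ 2 = t ^+ 2 * c ^+ 2 by ring.
    have -> : t * b * (t * a) = t ^+ 2 * (a * b) by ring.
    by rewrite ler_wpM2l // sqr_ge0.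
pose w i := y i / v i.
have yw : y =1 (fun i => v i * w i) by move=> i; rewrite /w mulrC divfK.
rewrite (eq_bil _ yw yw) -bil_scale; apply: KL; rewrite bil_scale -vy.
by apply: eq_bil => // i; rewrite mulr1.
Qed.

End Forms.

(** * Symmetric multilinear forms *)

Fixpoint every (T : Type) (P : T -> Prop) (s : seq T) : Prop :=
  if s is x :: s' then P x /\ every P s' else True.

Lemma every_impl (T : Type) (P Q : T -> Prop) s :
  (forall x, P x -> Q x) -> every P s -> every Q s.
Proof. by move=> PQ; elim: s => //= x s IH [/PQ Qx /IH]. Qed.

Lemma every_nseq (T : Type) (P : T -> Prop) k x : P x -> every P (nseq k x).
Proof. by move=> Px; elim: k. Qed.

Lemma every_cat (T : Type) (P : T -> Prop) s1 s2 : every P s1 -> every P s2 -> every P (s1 ++ s2).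
Proof. by elim: s1 => //= x s1 IH [Px /IH h] /h. Qed.

Section Contraction.
Variables (R : realFieldType) (n : nat).
Implicit Types (F : seq 'I_n -> R) (v x y z : 'I_n -> R) (vs : seq ('I_n -> R)).

(* A symmetric function F on words encodes, on the words of length d, a
   symmetric d-linear form; [contrs vs F] plugs the vectors vs into it. *)
Definition contr v F (u : seq 'I_n) : R := \sum_i v i * F (i :: u).

Definition contrs vs F := foldr contr F vs.

Definition symw F := forall u w, perm_eq u w -> F u = F w.

Definition quad F i j := F [:: i; j].

Definition prefix_word (w : seq 'I_n) F u := F (w ++ u).

Definition ones : 'I_n -> R := fun=> 1.

Definition vpos v := forall i, 0 < v i.

Definition vnneg v := forall i, 0 <= v i.

Lemma vpos_nneg v : vpos v -> vnneg v.
Proof. by move=> v0 i; apply: ltW. Qed.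

Lemma vpos_ones : vpos ones.
Proof. by move=> i; apply: ltr01. Qed.

Lemma vnneg_ones : vnneg ones.
Proof. exact/vpos_nneg/vpos_ones. Qed.

(** For the form of a homogeneous polynomial of degree [m + 2] this matrix is the Hessian, at the
    all-ones vector, of the derivative along [w], times [(m - size w)!]. *)
Definition local_lorentz m F := forall w : seq 'I_n, (size w <= m)%N ->
  lorentz (quad (contrs (nseq (m - size w) ones) (prefix_word w F))) ones.

Lemma contrs_cat vs1 vs2 F : contrs (vs1 ++ vs2) F = contrs vs1 (contrs vs2 F).
Proof. exact: foldr_cat. Qed.

Lemma symw_contr v F : symw F -> symw (contr v F).
Proof. by move=> sF u w uw; apply: eq_bigr => i _; rewrite (sF _ (i :: w)) // perm_cons. Qed.

Lemma symw_contrs vs F : symw F -> symw (contrs vs F).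
Proof. by move=> sF; elim: vs => //= v vs; apply: symw_contr. Qed.

Lemma contr_ge0 v F : vnneg v -> (forall u, 0 <= F u) -> forall u, 0 <= contr v F u.
Proof. by move=> v0 F0 u; apply: sumr_ge0 => i _; rewrite mulr_ge0. Qed.

Lemma contrs_ge0 vs F : every vnneg vs -> (forall u, 0 <= F u) ->
  forall u, 0 <= contrs vs F u.
Proof.
by elim: vs => //= v vs IH [v0 vs0] F0 u; apply: contr_ge0 => // {}u; apply: IH.
Qed.

Lemma contrC v w F : symw F -> contr v (contr w F) = contr w (contr v F).
Proof.
move=> sF; apply: boolp.funext => u; rewrite /contr.
under eq_bigr do rewrite mulr_sumr.
rewrite exchange_big; apply: eq_bigr => i _; rewrite mulr_sumr.
apply: eq_bigr => j _; rewrite mulrCA (sF (i :: j :: u) (j :: i :: u)) //.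
by rewrite -[i :: j :: u]/([:: i] ++ [:: j] ++ u) perm_catCA.
Qed.

Lemma contr_contrs v vs F : symw F -> contr v (contrs vs F) = contrs vs (contr v F).
Proof.
move=> sF; elim: vs => //= w vs <-; apply: contrC; exact: symw_contrs.
Qed.

Lemma contrs_catC vs1 vs2 F : symw F -> contrs (vs1 ++ vs2) F = contrs (vs2 ++ vs1) F.
Proof.
move=> sF; elim: vs1 vs2 => [|v vs1 IH] vs2; first by rewrite cats0.
rewrite /= IH -/(contrs (v :: vs2 ++ vs1) F) contrs_cat [RHS]contrs_cat /= contr_contrs //.
exact: symw_contrs.
Qed.

Lemma prefix_word_contr w v F : symw F ->
  prefix_word w (contr v F) = contr v (prefix_word w F).
Proof.
move=> sF; apply: boolp.funext => u; apply: eq_bigr => i _.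
by rewrite /prefix_word (sF _ (w ++ i :: u)) // perm_sym -cat1s perm_catCA.
Qed.

Lemma symw_prefix_word w F : symw F -> symw (prefix_word w F).
Proof. by move=> sF u u' uu; apply: sF; rewrite perm_cat2l. Qed.

Lemma prefix_word_contrs w vs F : symw F ->
  prefix_word w (contrs vs F) = contrs vs (prefix_word w F).
Proof.
move=> sF; elim: vs => //= v vs <-; apply: prefix_word_contr; exact: symw_contrs.
Qed.

Lemma bil_quad F x y : symw F -> bil (quad F) x y = contrs [:: x; y] F [::].
Proof.
move=> sF; apply: eq_bigr => i _; rewrite mulr_sumr; apply: eq_bigr => j _.
by rewrite /quad (sF [:: i; j] [:: j; i]) ?(perm_catC [:: i]) //; ring.
Qed.

Lemma sym2_quad F : symw F -> sym2 (quad F).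
Proof. by move=> sF i j; apply: sF; rewrite (perm_catC [:: i]). Qed.

(** A sum of nonnegative terms is nonzero as soon as one term is, so positive weights do not change
    the zero pattern. *)
Lemma contr_neq0 v F F' : vpos v -> (forall u, 0 <= F u) -> (forall u, 0 <= F' u) ->
  (forall u, (F u != 0) = (F' u != 0)) ->
  forall u, (contr v F u != 0) = (contr ones F' u != 0).
Proof.
move=> v0 F0 F'0 E u; have v0' := vpos_nneg v0.
rewrite /contr !psumr_neq0; last by move=> i _; rewrite mulr_ge0.
  by apply: eq_has => i /=; rewrite pmulr_rgt0 // mul1r !lt0r E F0 F'0.
by move=> i _; rewrite mulr_ge0 ?ler01.
Qed.

Lemma contrs_neq0 vs F : every vpos vs -> (forall u, 0 <= F u) ->
  forall u, (contrs vs F u != 0) = (contrs (nseq (size vs) ones) F u != 0).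
Proof.
elim: vs => //= v vs IH [v0 vs0] F0.
apply: contr_neq0; [exact: v0| | |exact: IH] => u; apply: contrs_ge0 => //.
- exact: every_impl vpos_nneg vs0.
- exact/every_nseq/vnneg_ones.
Qed.

(** The Alexandrov-Fenchel inequality; [y] may have any signs. *)
Definition af m F := forall vs u y, size vs = m -> every vnneg vs -> vnneg u ->
  contrs [:: u, u & vs] F [::] * contrs [:: y, y & vs] F [::]
    <= contrs [:: u, y & vs] F [::] ^+ 2.

Lemma af_pos m F : symw F -> (forall u, 0 <= F u) -> local_lorentz m F ->
  forall vs u y, size vs = m -> every vpos vs -> vnneg u ->
  contrs [:: u, u & vs] F [::] * contrs [:: y, y & vs] F [::]
    <= contrs [:: u, y & vs] F [::] ^+ 2.
Proof.
move=> sF F0 LF vs u y Svs vs0 u0.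
suff [p Lp] : exists p, lorentz (quad (contrs vs F)) p.
  have sG : symw (contrs vs F) by exact: symw_contrs.
  rewrite -[[:: u, u & vs]]/([:: u; u] ++ vs) -[[:: y, y & vs]]/([:: y; y] ++ vs).
  rewrite -[[:: u, y & vs]]/([:: u; y] ++ vs) !contrs_cat -!bil_quad //.
  apply: lorentz_cauchy (sym2_quad sG) Lp _.
  rewrite bil_quad //; apply: contrs_ge0 => //.
  by apply: contrs_ge0 => //; apply: every_impl vpos_nneg vs0.
elim: m F sF F0 LF vs Svs vs0 {u y u0} => [|m IH] F sF F0 LF [|v vs] //= => [_ _|[Svs] vs0].
  by exists ones; apply: (LF [::]).
case: (vs0) => v0 vs0'; exists v.
pose E i j k := contrs vs F [:: i; j; k].
have sE : symw (contrs vs F) by exact: symw_contrs.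
have E0 u : 0 <= contrs vs F u.
  by apply: contrs_ge0 => //; apply: every_impl vpos_nneg vs0'.
have Ei i : E i = quad (contrs vs (prefix_word [:: i] F)).
  by rewrite -prefix_word_contrs.
apply: (@tensor_step _ _ E v) => [i j k|i j k|i j k|||].
- by apply: sE; rewrite (perm_catCA [:: i] [:: j]).
- by apply: sE; rewrite perm_cons (perm_catC [:: j]).
- exact: E0.
- exact: v0.
- move=> i y.
  have sFi : symw (prefix_word [:: i] F) by exact: symw_prefix_word.
  have [||w Sw|p Lp] := IH (prefix_word [:: i] F) _ _ _ vs Svs vs0' => //.
  + by move=> u; apply: F0.
  + by have := LF (i :: w) Sw; rewrite /= subSS.
  rewrite Ei; apply: lorentz_cauchy Lp _; first exact/sym2_quad/symw_contrs.
  rewrite -Ei; apply: sumr_ge0 => j _; apply: sumr_ge0 => k _.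
  by rewrite mulr_ge0 ?E0 // mulr_ge0 // ltW.
- have L1 := LF [::] isT; rewrite subn0 /prefix_word in L1.
  have : conn (quad (contrs (nseq m.+1 ones) F)).
    apply: lorentz_conn L1; first exact/sym2_quad/symw_contrs.
    move=> i j; apply: contrs_ge0 => //; apply: every_nseq; exact: vnneg_ones.
  apply: conn_supp => i j; rewrite -Svs.
  by rewrite /quad -(@contrs_neq0 (v :: vs) F vs0 F0 [:: i; j]).
Qed.

Lemma limit_ge0 (p q r : R) : (forall e, 0 < e -> e <= 1 -> 0 <= p + e * q + e ^+ 2 * r) -> 0 <= p.
Proof.
move=> h; rewrite leNgt; apply/negP => p0.
pose s := `|q| + `|r| + 1.
have s0 : 0 < s by rewrite ltr_wpDl // addr_ge0.
(* With this [e] the perturbation is at most [- p / 2], too small to make up for a negative [p]. *)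
pose e := Num.min 1 (- p / (2 * s)).
have e0 : 0 < e by rewrite lt_min ltr01 divr_gt0 // ?mulr_gt0 // oppr_gt0.
have e1 : e <= 1 by rewrite ge_min lexx.
have es : e * s <= - p / 2.
  rewrite (_ : - p / 2 = - p / (2 * s) * s); last by field; rewrite gt_eqF.
  by rewrite ler_pM2r // ge_min lexx orbT.
have eq : e * q <= e * `|q| by rewrite ler_pM2l // ler_norm.
have er : e ^+ 2 * r <= e * `|r|.
  rewrite expr2 -mulrA ler_pM2l //; apply: le_trans (_ : e * `|r| <= _).
    by rewrite ler_pM2l // ler_norm.
  by rewrite ler_piMl.
have := h e e0 e1; move: es; rewrite /s !mulrDr mulr1; lra.
Qed.

Lemma limit_quadratic (a a' b b' c c' : R) :
  (forall e, 0 < e -> (a + e * a') * (c + e * c') <= (b + e * b') ^+ 2) ->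
  a * c <= b ^+ 2.
Proof.
move=> h; rewrite -subr_ge0.
apply: (@limit_ge0 _ (2 * b * b' - a * c' - a' * c) (b' ^+ 2 - a' * c')) => e e0 _.
by have := h e e0; rewrite -subr_ge0 => /le_trans; apply; rewrite le_eqVlt; apply/orP; left; apply/eqP; ring.
Qed.

Lemma contrs_lin vs v w e F : symw F ->
  contrs vs (contr (fun i => v i + e * w i) F) =
  (fun u => contrs vs (contr v F) u + e * contrs vs (contr w F) u).
Proof.
move=> sF; rewrite -!contr_contrs //; apply: boolp.funext => u; rewrite /contr mulr_sumr -big_split /=.
by apply: eq_bigr => i _; ring.
Qed.

(** A nonnegative vector [v] is replaced by the positive [v + e 1]. The contractions are affine in
    [e], so the inequality survives [e -> 0]. *)
Lemma local_lorentz_af m F : symw F -> (forall u, 0 <= F u) -> local_lorentz m F -> af m F.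
Proof.
move=> sF F0 LF.
(* [vs1] holds the vectors still to be perturbed, [vs2] those already positive. *)
suff H k vs1 vs2 : size vs1 = k -> forall u y, size (vs1 ++ vs2) = m -> every vnneg vs1 ->
   every vpos vs2 -> vnneg u ->
  contrs [:: u, u & vs1 ++ vs2] F [::] * contrs [:: y, y & vs1 ++ vs2] F [::]
    <= contrs [:: u, y & vs1 ++ vs2] F [::] ^+ 2.
  move=> vs u y S vs0 u0; have := H _ vs [::] erefl u y.
  by rewrite cats0; apply.
elim: k vs1 vs2 => [|k IH] [|v vs1] vs2 // => [_|[Svs]] u y S vs1p vs2p u0.
  exact: (af_pos sF F0 LF).
case: vs1p => v0 vs1p.
have mv a b : contrs [:: a, b, v & vs1 ++ vs2] F = contrs [:: a, b & vs1 ++ vs2] (contr v F).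
  by rewrite /= -[contr v (foldr _ _ _)]/(contr v (contrs _ _)) contr_contrs.
rewrite cat_cons !mv.
pose X a b w := contrs [:: a, b & vs1 ++ vs2] (contr w F) [::].
apply: (@limit_quadratic _ (X u u ones) _ (X u y ones) _ (X y y ones)) => e e0.
pose v' i := v i + e * ones i.
have v'0 : vpos v' by move=> i; rewrite /v' /ones mulr1 ltr_wpDl.
have L a b : contrs [:: a, b & vs1 ++ vs2] (contr v F) [::] + e * X a b ones = X a b v'.
  by rewrite /X contrs_lin.
rewrite !L.
have mv' a b : X a b v' = contrs [:: a, b & vs1 ++ v' :: vs2] F [::].
  rewrite /X -[a :: b :: _]/([:: a; b] ++ _) -[a :: b :: vs1 ++ _]/([:: a; b] ++ _).
  by rewrite !contrs_cat /= -contr_contrs.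
rewrite !mv'; apply: IH => //.
- by move: S; rewrite !size_cat /= addnS.
Qed.

End Contraction.

(** * Log-concavity of functions *)

(** The increments decrease: from [a] on they are at most [D], before [a] at least [D]. Adding up
    each kind compares [l a] with both ends. *)
Lemma concave_seq_chord (R : realFieldType) (m : nat) (l : nat -> R) :
  (forall a, (a.+2 <= m)%N -> l a + l a.+2 <= 2 * l a.+1) ->
  forall a, (a <= m)%N -> a%:R * l m + (m - a)%:R * l 0%N <= m%:R * l a.
Proof.
move=> cl a; rewrite leq_eqVlt => /orP[/eqP ->|am]; first by rewrite subnn mul0r addr0.
pose D := l a.+1 - l a.
have up k : (a + k < m)%N -> l (a + k).+1 - l (a + k)%N <= D.
  elim: k => [|k IH]; rewrite ?addn0 // addnS => akm.
  have := cl _ akm; have := IH (ltnW akm); lra.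
have down k : (k <= a)%N -> D <= l (a - k).+1 - l (a - k)%N.
  elim: k => [|k IH] ka; first by rewrite subn0.
  have E : (a - k = (a - k.+1).+1)%N by rewrite subnSK.
  have h : ((a - k.+1).+2 <= m)%N by rewrite -E (leq_trans _ am) // ltnS leq_subr.
  have := cl _ h; have := IH (ltnW ka); rewrite E; lra.
have U k : (a + k <= m)%N -> l (a + k)%N - l a <= k%:R * D.
  elim: k => [|k IH]; first by rewrite addn0 subrr mul0r.
  rewrite addnS => akm; have := up k akm; have := IH (ltnW akm).
  by rewrite -natr1 mulrDl mul1r; lra.
have L k : (k <= a)%N -> k%:R * D <= l a - l (a - k)%N.
  elim: k => [|k IH] ka; first by rewrite subn0 subrr mul0r.
  have := down _ ka; have := IH (ltnW ka); rewrite subnSK // -natr1 mulrDl mul1r; lra.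
have := U (m - a)%N; rewrite subnKC ?(ltnW am) // => /(_ (leqnn _)).
have := L a (leqnn a); rewrite subnn.
have -> : m%:R = (m - a)%:R + a%:R :> R by rewrite -natrD subnK // ltnW.
move: (ler0n R a) (ler0n R (m - a)); move: (l m) (l a) (l 0%N) D {up down U L}.
move: (a%:R : R) ((m - a)%:R : R) => p q lm la l0 D p0 q0 h1 h2; nra.
Qed.

Module Export Analysis.
Import constructive_ereal sequences exp.

(** A log-concave sequence dominates the geometric one with the same ends, so the sum is at least
    the [m]-th power of the [t]-weighted mean of the [m]-th roots of [g x] and [g y]; the
    arithmetic-geometric mean inequality finishes. *)
Lemma log_concave_binomial (R : realType) (n m : nat) (g : ('I_n -> R) -> R) :
  (forall x, positive x -> 0 <= g x) ->
  (forall x y t, positive x -> positive y -> 0 < t < 1 -> 0 < g x -> 0 < g y ->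
    exists s : nat -> R,
      [/\ forall a, (a <= m)%N -> 0 < s a,
          forall a, (a.+2 <= m)%N -> s a * s a.+2 <= s a.+1 ^+ 2,
          s 0%N = g y, s m = g x &
          g (fun i => t * x i + (1 - t) * y i) =
            \sum_(a < m.+1) 'C(m, a)%:R * (t ^+ a * (1 - t) ^+ (m - a) * s a)]) ->
  log_concave g.
Proof.
move=> g0 hg x y t px py t01.
have [t0 t1] := andP t01; have t1' : 0 < 1 - t by rewrite subr_gt0.
(* If [g] vanishes at an endpoint, the left side is -oo. *)
have [gx|gx] := eqVneq (g x) 0.
  rewrite (@le0_lneNy _ (g x)%:E) ?gx // gt0_muleNy ?lte_fin // addNye; exact: leNye.
have [gy|gy] := eqVneq (g y) 0.
  rewrite (@le0_lneNy _ (g y)%:E) ?gy // (@gt0_muleNy _ (1 - t)%:E) ?lte_fin // addeNy; exact: leNye.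
have {}gx : 0 < g x by rewrite lt_neqAle eq_sym gx g0.
have {}gy : 0 < g y by rewrite lt_neqAle eq_sym gy g0.
have [s [s0 sc sy sx E]] := hg x y t px py t01 gx gy.
have gz : expR (t * ln (g x) + (1 - t) * ln (g y)) <= g (fun i => t * x i + (1 - t) * y i).
  have [m0|m0] := posnP m.
    rewrite E m0 big_ord_recl big_ord0 bin0 !expr0 !mul1r addr0 -sx -sy m0.
    by rewrite -mulrDl addrC subrK mul1r lnK // posrE s0.
  have m0' : (m%:R : R) != 0 by rewrite pnatr_eq0 -lt0n.
  pose u := ln (g x) / m%:R; pose v := ln (g y) / m%:R; pose c := t * u + (1 - t) * v.
  have key : expR c <= t * expR u + (1 - t) * expR v.
    (* Tangent line of the exponential at the weighted mean [c]; averaging it over [u] and [v] is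
       the arithmetic-geometric mean inequality. *)
    have h w : expR c * (1 + (w - c)) <= expR w.
      have -> : expR w = expR c * expR (w - c) by rewrite -expRD; congr expR; ring.
      rewrite ler_pM2l ?expR_gt0 //; exact: expR_ge1Dx.
    have hu := h u; have hv := h v.
    rewrite (_ : expR c = t * (expR c * (1 + (u - c))) + (1 - t) * (expR c * (1 + (v - c)))); last first.
      by rewrite /c; ring.
    by rewrite lerD // ler_pM2l.
  have -> : t * ln (g x) + (1 - t) * ln (g y) = m%:R * c by rewrite /c /u /v; field.
  rewrite expRM_natl E.
  apply: le_trans (_ : (t * expR u + (1 - t) * expR v) ^+ m <= _).
    by rewrite lerXn2r // nnegrE ?expR_ge0 // addr_ge0 // mulr_ge0 ?expR_ge0 // ltW.
  rewrite addrC exprDn; apply: ler_sum => -[a /= am] _; rewrite ltnS in am.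
  have lc b : (b.+2 <= m)%N -> ln (s b) + ln (s b.+2) <= 2 * ln (s b.+1).
    move=> bm; have p0 := s0 b (ltnW (ltnW bm)); have p1 := s0 b.+1 (ltnW bm); have p2 := s0 _ bm.
    rewrite -lnM ?posrE // mulr_natl -lnXn // ler_ln ?posrE ?mulr_gt0 ?exprn_gt0 //; exact: sc.
  have := concave_seq_chord lc am; rewrite sx sy => ch.
  have sa : expR u ^+ a * expR v ^+ (m - a) <= s a.
    rewrite -!expRM_natl -expRD -[s a]lnK ?posrE ?s0 // ler_expR.
    rewrite -(ler_pM2l (_ : 0 < m%:R)) ?ltr0n //; apply: le_trans ch.
    by rewrite le_eqVlt; apply/orP; left; apply/eqP; rewrite /u /v; field.
  rewrite -mulr_natl ler_wpM2l ?ler0n // !exprMn.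
  rewrite (_ : _ * _ = t ^+ a * (1 - t) ^+ (m - a) * (expR u ^+ a * expR v ^+ (m - a))); last by ring.
  by rewrite ler_wpM2l // mulr_ge0 // exprn_ge0 // ltW.
rewrite !lne_EFin //; last exact: lt_le_trans (expR_gt0 _) gz.
rewrite -!EFinM -EFinD lee_fin -[leLHS]expRK ler_ln ?posrE ?expR_gt0 //.
exact: lt_le_trans (expR_gt0 _) gz.
Qed.

Lemma log_concave_midpoint (R : realType) (n : nat) (g : ('I_n -> R) -> R) (x y : 'I_n -> R) :
  (forall x, positive x -> 0 <= g x) -> log_concave g -> positive x -> positive y ->
  g x * g y <= g (fun i => 2^-1 * x i + (1 - 2^-1) * y i) ^+ 2.
Proof.
move=> g0 lg px py.
have [gx|gx] := eqVneq (g x) 0; first by rewrite gx mul0r sqr_ge0.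
have [gy|gy] := eqVneq (g y) 0; first by rewrite gy mulr0 sqr_ge0.
have {}gx : 0 < g x by rewrite lt_neqAle eq_sym gx g0.
have {}gy : 0 < g y by rewrite lt_neqAle eq_sym gy g0.
have h : 0 < (2^-1 : R) < 1 by lra.
have := lg x y 2^-1 px py h; set z := (fun i => _).
have pz : positive z by move=> i; rewrite /z; have := px i; have := py i; lra.
(* A zero at the midpoint would put -oo above a finite value. *)
have := g0 z pz; rewrite le_eqVlt => /orP[/eqP <-|gz].
  by rewrite (@le0_lneNy _ 0%:E) // !lne_EFin // -!EFinM -EFinD leeNy_eq.
rewrite !lne_EFin // -!EFinM -EFinD lee_fin => L.
rewrite -ler_ln ?posrE ?mulr_gt0 ?exprn_gt0 // lnM ?posrE // lnXn // mulr2n; lra.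
Qed.

End Analysis.

From mathcomp Require Import mpoly.

(** * Completely log-concave polynomials *)

Section PolynomialForms.
Variables (R : realType) (n : nat).
Implicit Types (g : {mpoly R[n]}) (u w : seq 'I_n) (v x y z : 'I_n -> R).

(** The polar form without division: for [g] homogeneous of degree [d] and words of length [d], the
    constant [d]-th derivatives. Plugging in [z] everywhere gives [d!] times the value at [z]. *)
Definition wform g u : R := (foldr (@mderiv n R) g u)@_0.

Definition dir_deriv v g : {mpoly R[n]} := \sum_i v i *: mderiv i g.

Lemma meval_sum (I : Type) (r : seq I) (p : I -> {mpoly R[n]}) v :
  (\sum_(a <- r) p a).@[v] = \sum_(a <- r) (p a).@[v].
Proof. exact: raddf_sum. Qed.

Lemma mderiv_sum (I : Type) (r : seq I) (p : I -> {mpoly R[n]}) i :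
  mderiv i (\sum_(a <- r) p a) = \sum_(a <- r) mderiv i (p a).
Proof. exact: raddf_sum. Qed.

Lemma euler m g v : g \is m.-homog ->
  \sum_i v i * (mderiv i g).@[v] = m%:R * g.@[v].
Proof.
move=> /dhomogP hg.
have D i : v i * (mderiv i g).@[v] =
    \sum_(a <- msupp g) g@_a * ((a i)%:R * 'X_[a].@[v]).
  have -> : mderiv i g = \sum_(a <- msupp g) mderiv i (g@_a *: 'X_[a]).
    by rewrite [in LHS](mpolyE g) mderiv_sum.
  rewrite meval_sum mulr_sumr; apply: eq_bigr => a _.
  rewrite mderivZ mderivX !mevalZ mulrCA; congr (_ * _).
  rewrite mulrCA; have [->|ai] := posnP (a i); first by rewrite !mul0r.
  congr (_ * _); have ua : (U_(i) <= a)%MM.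
    by apply/mnm_lepP => j; rewrite mnm1E; case: eqP => // <-.
  by rewrite -[in RHS](submK ua) mpolyXD mevalM mevalXU mulrC.
under eq_bigr do rewrite D.
rewrite exchange_big [in RHS](mpolyE g) meval_sum mulr_sumr !big_seq.
apply: eq_bigr => a /hg ag; rewrite mevalZ mulrCA -mulr_sumr; congr (_ * _).
by rewrite -mulr_suml -natr_sum -ag /= mdegE.
Qed.

Lemma dhomog_mderiv m g i : g \is m.-homog -> mderiv i g \is m.-1.-homog.
Proof.
move=> /dhomogP hg; apply/dhomogP => a; rewrite mcoeff_msupp mcoeff_deriv => ha.
have /hg : (a + U_(i))%MM \in msupp g.
  by rewrite mcoeff_msupp; apply: contraNneq ha => ->; rewrite mul0rn.
by rewrite /= mdegD mdeg1 addn1 => <-.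
Qed.

Lemma dhomog_dir_deriv m g v : g \is m.-homog -> dir_deriv v g \is m.-1.-homog.
Proof. by move=> hg; apply: rpred_sum => i _; apply/rpredZ/dhomog_mderiv. Qed.

Lemma dhomog0_const g : g \is 0.-homog -> g = (g@_0)%:MP.
Proof.
move=> /dhomogP hg; apply/mpolyP => a; rewrite mcoeffC.
have [->|a0] := eqVneq a 0%MM; first by rewrite mulr1.
rewrite mulr0; apply/eqP; rewrite mcoeff_eq0.
by apply: contra a0 => /hg /= /eqP; rewrite mdeg_eq0.
Qed.

Lemma dir_deriv_const g v : g \is 0.-homog -> dir_deriv v g = 0.
Proof.
by move=> /dhomog0_const ->; apply: big1 => i _; rewrite mderivC scaler0.
Qed.

Lemma symw_wform g : symw (wform g).
Proof. by move=> u w uw; rewrite /wform (mderiv_perm _ uw). Qed.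

Lemma wform_dir_deriv v g : wform (dir_deriv v g) = contr v (wform g).
Proof.
apply: boolp.funext => u; rewrite /contr.
transitivity (\sum_i v i * wform g (u ++ [:: i])); last first.
  by apply: eq_bigr => i _; rewrite (@symw_wform g (u ++ [:: i]) (i :: u)) // perm_catC.
rewrite /wform /dir_deriv.
have -> : foldr (@mderiv n R) (\sum_i v i *: mderiv i g) u =
    \sum_i v i *: foldr (@mderiv n R) g (u ++ [:: i]).
  elim: u => [|j u IH] //=; rewrite IH mderiv_sum; apply: eq_bigr => i _.
  by rewrite mderivZ.
by rewrite raddf_sum; apply: eq_bigr => i _ /=; rewrite mcoeffZ.
Qed.

(** Each contraction by [z] is one use of Euler's identity, whence the factorial. *)
Lemma meval_wform m g z : g \is m.-homog ->
  m`!%:R * g.@[z] = contrs (nseq m z) (wform g) [::].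
Proof.
elim: m g => [|m IH] g hg.
  by rewrite (dhomog0_const hg) mevalC fact0 mul1r /= /wform /= mcoeffC eqxx mulr1.
rewrite /= contr_contrs; last exact: symw_wform.
rewrite -wform_dir_deriv -IH; last exact: (dhomog_dir_deriv z hg).
rewrite /dir_deriv meval_sum.
under [in RHS]eq_bigr do rewrite mevalZ.
by rewrite (euler z hg) factS natrM; ring.
Qed.

Definition columns k (V : 'M[R]_(n, k)) := [seq (fun i => V i j) | j <- enum 'I_k].

Lemma size_columns k (V : 'M[R]_(n, k)) : size (columns V) = k.
Proof. by rewrite size_map size_enum_ord. Qed.

Lemma D_mx_foldr k (V : 'M[R]_(n, k)) g : D_mx V g = foldr dir_deriv g (columns V).
Proof. by rewrite /D_mx /columns foldr_map. Qed.

Lemma wform_D_mx k (V : 'M[R]_(n, k)) g :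
  wform (D_mx V g) = contrs (columns V) (wform g).
Proof. by rewrite D_mx_foldr; elim: (columns V) => //= v vs <-; rewrite wform_dir_deriv. Qed.

Lemma dhomog_dir_derivs d vs g : g \is d.-homog ->
  foldr dir_deriv g vs \is (d - size vs).-homog.
Proof.
move=> hg; elim: vs => [|v vs IH] /=; first by rewrite subn0.
by rewrite subnS; apply: dhomog_dir_deriv.
Qed.

Lemma dhomog_D_mx d k (V : 'M[R]_(n, k)) g : g \is d.-homog -> D_mx V g \is (d - k).-homog.
Proof. by move=> /(dhomog_dir_derivs (columns V)); rewrite D_mx_foldr size_columns. Qed.

Lemma D_mx_eq0 d k (V : 'M[R]_(n, k)) g : g \is d.-homog -> (d < k)%N -> D_mx V g = 0.
Proof.
move=> hg; rewrite D_mx_foldr -[k in (_ < k)%N](size_columns V).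
elim: (columns V) => //= v vs IH; rewrite ltnS leq_eqVlt => /orP[/eqP E|/IH ->]; last first.
  by rewrite /dir_deriv big1 // => i _; rewrite mderiv0 scaler0.
apply: dir_deriv_const; have := dhomog_dir_derivs vs hg; by rewrite -E subnn.
Qed.

Lemma wform_ge0 g : (forall a, 0 <= g@_a) -> forall u, 0 <= wform g u.
Proof.
move=> g0 u; rewrite /wform; move: 0%MM; elim: u => //= i u IH a.
by rewrite mcoeff_deriv mulrn_wge0.
Qed.

Lemma every_columns k (V : 'M[R]_(n, k)) : (forall i j, 0 <= V i j) -> every (@vnneg R n) (columns V).
Proof. by move=> V0; rewrite /columns; elim: (enum _) => //= j s IH; split. Qed.

End PolynomialForms.

(** * Binomial expansion of a symmetric form *)

Section BinomialExpansion.
Variables (R : realType) (n : nat).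
Implicit Types (F : seq 'I_n -> R) (g : {mpoly R[n]}) (u w : seq 'I_n) (v x y z : 'I_n -> R).

Lemma pascal_sum (m : nat) (P : nat -> nat -> R) :
  \sum_(a < m.+2) 'C(m.+1, a)%:R * P a (m.+1 - a)%N =
  \sum_(a < m.+1) 'C(m, a)%:R * (P a.+1 (m - a)%N + P a (m - a).+1).
Proof.
rewrite big_ord_recl /= bin0 mul1r subn0.
under eq_bigr => a _ do rewrite /bump /= add1n binS natrD mulrDl subSS addrC.
under [RHS]eq_bigr => a _ do rewrite mulrDr.
rewrite !big_split /= addrCA; congr (_ + _).
transitivity (\sum_(a < m.+2) 'C(m, a)%:R * P a (m.+1 - a)%N).
  by rewrite [RHS]big_ord_recl /= bin0 mul1r subn0; congr (_ + _); apply: eq_bigr => a _.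
rewrite big_ord_recr /= bin_small // mul0r addr0; apply: eq_bigr => -[a /= am] _.
by rewrite subSn.
Qed.

Lemma contrs_binomial m x y (s t : R) F : symw F ->
  contrs (nseq m (fun i => s * x i + t * y i)) F [::] =
  \sum_(a < m.+1) 'C(m, a)%:R *
     (s ^+ a * t ^+ (m - a) * contrs (nseq a x ++ nseq (m - a) y) F [::]).
Proof.
elim: m F => [|m IH] F sF.
  by rewrite big_ord_recl big_ord0 /= !expr0 !mul1r addr0.
set z := fun i => _.
rewrite (pascal_sum m (fun a b => s ^+ a * t ^+ b * contrs (nseq a x ++ nseq b y) F [::])).
rewrite /= contr_contrs // IH; last exact: symw_contr.
apply: eq_bigr => a _; congr (_ * _); rewrite !contrs_cat /=.
have L G : symw G -> contr z G = (fun u => s * contr x G u + t * contr y G u).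
  move=> sG; apply: boolp.funext => u; rewrite /contr !mulr_sumr -big_split /=.
  by apply: eq_bigr => i _; rewrite /z; ring.
have sE := symw_contrs (nseq a x) (symw_contrs (nseq (m - a) y) sF).
have sE' : symw (contrs (nseq (m - a) y) F) by exact: symw_contrs.
rewrite -(contr_contrs z _ sF) -(contr_contrs z _ sE') -(contr_contrs y _ sE') L //.
by rewrite !exprS; ring.
Qed.

End BinomialExpansion.

(** * Complete log-concavity and the local test *)

Section Criterion.
Variables (R : realType) (n : nat).
Implicit Types (F : seq 'I_n -> R) (g : {mpoly R[n]}) (u w : seq 'I_n) (v x y z : 'I_n -> R).

Lemma contrs_catCA vs1 vs2 vs3 F : symw F ->
  contrs (vs1 ++ vs2 ++ vs3) F = contrs (vs2 ++ vs1 ++ vs3) F.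
Proof.
move=> sF; rewrite !catA [in LHS]contrs_cat [in RHS]contrs_cat contrs_catC //.
exact: symw_contrs.
Qed.

(** For [d < 2] nothing is assumed: the sequences produced on segments have at most two terms, and
    their log-concavity is vacuous. *)
Lemma af_clc d g : g \is d.-homog -> (forall a, 0 <= g@_a) ->
  ((2 <= d)%N -> af (d - 2) (wform g)) -> completely_log_concave g.
Proof.
move=> hg g0 AF k V V0.
have [dk|kd] := ltnP d k.
  rewrite (D_mx_eq0 V hg dk).
  have E x : (0 : {mpoly R[n]}).@[x] = 0 by rewrite meval0.
  split=> [x _|]; first by rewrite E.
  by apply: (@log_concave_binomial _ _ 0) => [x _|x y t _ _ _]; rewrite !E ?ltxx.
set h := D_mx V g; set m := (d - k)%N.
have hh : h \is m.-homog by exact: dhomog_D_mx.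
have hE z : h.@[z] = contrs (nseq m z) (wform h) [::] / m`!%:R.
  by rewrite -(meval_wform z hh) mulrC mulKf // pnatr_eq0 -lt0n fact_gt0.
have sh : symw (wform h) by exact: symw_wform.
have h0 u : 0 <= wform h u.
  by rewrite wform_D_mx; apply: contrs_ge0 (wform_ge0 g0) _; apply: every_columns.
have f0 : 0 < (m`!%:R)^-1 :> R by rewrite invr_gt0 ltr0n fact_gt0.
have hx0 x : positive x -> 0 <= h.@[x].
  move=> px; rewrite hE mulr_ge0 ?(ltW f0) // contrs_ge0 //.
  by apply: every_nseq => i; apply: ltW.
split=> //; apply: (@log_concave_binomial _ _ m) => // x y t px py t01 hx hy.
have ex k' z : positive z -> every (@vpos R n) (nseq k' z) by move=> pz; apply: every_nseq.
have ex' k' z : positive z -> every (@vnneg R n) (nseq k' z).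
  by move=> pz; apply: every_nseq => i; apply: ltW.
pose P a b := contrs (nseq a x ++ nseq b y) (wform h) [::].
exists (fun a => P a (m - a)%N / m`!%:R); split=> [a am|a am|||].
(* Positivity of [h] at [x] makes the contraction with copies of [x] nonzero; the zero pattern is
   the same for every list of positive vectors of that length. *)
- rewrite mulr_gt0 // lt_neqAle eq_sym contrs_ge0 ?andbT //; last first.
    by apply: every_cat; apply: ex'.
  rewrite contrs_neq0 //; last by apply: every_cat; apply: ex.
  rewrite size_cat !size_nseq subnKC //.
  move: hx; rewrite hE pmulr_lgt0 // => /lt0r_neq0.
  by rewrite (contrs_neq0 (ex m x px) h0) size_nseq.
(* The columns of [V] are among the [d - 2] plugged vectors, so the inequality for [g] itself yields
   the one for its derivative [h]. *)
- have mE : m = (a + (m - a.+2)).+2 by rewrite -addn2 -addnA addn2; lia.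
  pose vs := nseq a x ++ nseq (m - a.+2) y ++ columns V.
  have svs : size vs = (d - 2)%N.
    by rewrite !size_cat !size_nseq size_columns addnA; move: kd mE; rewrite /m; lia.
  have d2 : (2 <= d)%N by move: mE kd; rewrite /m; lia.
  have vs0 : every (@vnneg R n) vs.
    do 2![apply: every_cat; first exact: ex'].
    exact: every_columns.
  have := AF d2 vs x y svs vs0 (vpos_nneg px).
  have T z1 z2 : contrs [:: z1, z2 & vs] (wform g) [::] =
     contrs ([:: z1; z2] ++ nseq a x ++ nseq (m - a.+2) y) (wform h) [::].
    by rewrite wform_D_mx -contrs_cat /vs !catA.
  rewrite !T.
  have -> : contrs ([:: y; y] ++ nseq a x ++ nseq (m - a.+2) y) (wform h) [::] = P a (m - a)%N.
    rewrite /P (_ : m - a = (m - a.+2).+2)%N; last lia.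
    exact: (congr1 (fun G => G [::]) (contrs_catCA [:: y; y] (nseq a x) (nseq (m - a.+2) y) sh)).
  have -> : contrs ([:: x; y] ++ nseq a x ++ nseq (m - a.+2) y) (wform h) [::] = P a.+1 (m - a.+1)%N.
    rewrite /P (_ : m - a.+1 = (m - a.+2).+1)%N; last lia.
    exact: (congr1 (fun G => contr x G [::]) (contrs_catCA [:: y] (nseq a x) (nseq (m - a.+2) y) sh)).
  rewrite -[contrs ([:: x; x] ++ _ ++ _) _ _]/(P a.+2 (m - a.+2)%N) => A.
  by rewrite /= mulrACA -expr2 exprMn ler_wpM2r ?sqr_ge0 // mulrC.
- by rewrite hE /P subn0.
- by rewrite hE /P subnn cats0.
- rewrite hE contrs_binomial // mulr_suml; apply: eq_bigr => a _; rewrite /P; ring.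
Qed.

(** Division by [s ^+ 2] leaves the second coefficient plus [s * r.[s]], with [r] bounded on the
    unit interval. *)
Lemma poly_limit (q : {poly R}) (b : R) : 0 < b ->
  (forall s, 0 < s -> s < b -> 0 <= q.[s]) -> q`_0 = 0 -> q`_1 = 0 -> 0 <= q`_2.
Proof.
move=> b0 h q0 q1.
pose r := drop_poly 3 q.
have qE s : q.[s] = s ^+ 2 * (q`_2 + s * r.[s]).
  rewrite -[in LHS](poly_take_drop 3 q) hornerD hornerM hornerXn -/r.
  rewrite /take_poly horner_poly !big_ord_recl big_ord0 /bump /= q0 q1; ring.
have rB s : 0 <= s <= 1 -> r.[s] <= \sum_(i < size r) `|r`_i|.
  move=> /andP[s0 s1]; rewrite horner_coef; apply: ler_sum => i _.
  apply: le_trans (ler_norm _) _; rewrite normrM ler_piMr // normrX ger0_norm //.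
  exact: exprn_ile1.
set K := \sum_(i < _) _ in rB.
pose c := Num.min 1 (b / 2).
have c0 : 0 < c by rewrite lt_min ltr01 divr_gt0.
have c1 : c <= 1 by rewrite ge_min lexx.
have cb : c < b by apply: le_lt_trans (_ : b / 2 < b); [rewrite ge_min lexx orbT|lra].
apply: (@limit_ge0 _ _ (c * K) 0) => e e0 e1; rewrite mulr0 addr0.
have s0 : 0 < e * c by rewrite mulr_gt0.
have s1 : e * c <= c by rewrite ler_piMl // ltW.
have := h _ s0 (le_lt_trans s1 cb); rewrite qE pmulr_rge0 ?exprn_gt0 // => /le_trans; apply.
rewrite lerD2l mulrA ler_pM2l //; apply: rB; rewrite (ltW s0) /=; exact: le_trans s1 c1.
Qed.

(** The second order condition without calculus: the values of [h] at [1 + s y] and [1 - s y] are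
    compared with that at their midpoint [1]. For [y] orthogonal to [1] the defect is a polynomial
    in [s] without terms of order 0 and 1. *)
Lemma clc_local_lorentz d g : g \is d.-homog -> (forall a, 0 <= g@_a) -> (2 <= d)%N ->
  completely_log_concave g -> local_lorentz (d - 2) (wform g).
Proof.
move=> hg g0 d2 C w sw.
(* The columns are coordinate vectors, so [D_mx V] is the derivative along [w]. *)
pose k := size w; pose V : 'M[R]_(n, k) := \matrix_(i, j) (i == tnth (in_tuple w) j)%:R.
have V0 i j : 0 <= V i j by rewrite mxE ler0n.
have [] := C k V V0; set h := D_mx V g => hx0 hlc.
pose m := (d - k)%N.
have hh : h \is m.-homog by exact: dhomog_D_mx.
have m2 : (2 <= m)%N by rewrite /m /k; lia.
have hE z : h.@[z] = contrs (nseq m z) (wform h) [::] / m`!%:R.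
  by rewrite -(meval_wform z hh) mulrC mulKf // pnatr_eq0 -lt0n fact_gt0.
have f0 : 0 < (m`!%:R)^-1 :> R by rewrite invr_gt0 ltr0n fact_gt0.
have sh : symw (wform h) by exact: symw_wform.
have h0 u : 0 <= wform h u.
  by rewrite wform_D_mx; apply: contrs_ge0 (wform_ge0 g0) _; apply: every_columns.
have hw : wform h = prefix_word w (wform g).
  rewrite wform_D_mx.
  have -> : columns V = [seq (fun i => (i == j)%:R) | j <- w].
    rewrite -[w in RHS]/(tval (in_tuple w)) -[in RHS](map_tnth_enum (in_tuple w)) -map_comp.
    by apply: eq_map => j; apply: boolp.funext => i; rewrite mxE.
  have sg := @symw_wform _ _ g; move: (wform g) sg => F sF {h hlc hx0 hh hE sh h0}.
  elim: w {sw k V V0 m m2 f0} => [|j w IH] /=; first exact: boolp.funext.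
  rewrite IH; apply: boolp.funext => u; rewrite /contr (bigD1 j) //= eqxx mul1r.
  rewrite big1 ?addr0 => [|i /negPf ->]; last by rewrite mul0r.
  by rewrite /prefix_word; apply: sF; rewrite -cat1s perm_catCA.
rewrite -hw (_ : (d - 2 - size w = m - 2)%N); last by rewrite /m /k; lia.
set Q := quad _ => y y1.
have sG : symw (contrs (nseq (m - 2) (@ones R n)) (wform h)) by exact: symw_contrs.
have mE : m = (m - 2).+2 by lia.
pose P a b := contrs (nseq a y ++ nseq b (@ones R n)) (wform h) [::].
have P2 : bil Q y y = P 2%N (m - 2)%N by rewrite bil_quad // -contrs_cat.
have P1 : P 1%N (m - 1)%N = 0.
  rewrite -y1 bil_quad // -contrs_cat /P (_ : m - 1 = (m - 2).+1)%N; last lia.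
  exact: (congr1 (fun G => G [::]) (contrs_catCA [:: y] [:: @ones R n] (nseq (m - 2) (@ones R n)) sh)).
have P0 : bil Q (@ones R n) (@ones R n) = P 0%N m by rewrite bil_quad // -contrs_cat [in RHS]mE.
have Q0 i j : 0 <= Q i j.
  by rewrite /Q; apply: contrs_ge0 => //; apply: every_nseq; apply: vnneg_ones.
have [A0|A0] := eqVneq (P 0%N m) 0.
  rewrite [bil _ _ _]big1 // => i _; apply: big1 => j _.
  have Q11 a b : 0 <= Q a b * (@ones R n a * @ones R n b) by rewrite mulr_ge0 // /ones mulr1.
  by have := sum2_ge0_eq0 Q11 (etrans P0 A0) i j; rewrite /ones !mulr1 => ->; rewrite mul0r.
have Ap : 0 < P 0%N m.
  by rewrite lt_neqAle eq_sym A0 -P0; apply: sumr_ge0 => i _; apply: sumr_ge0 => j _; rewrite mulr_ge0 // /ones mulr1.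
pose p (e : R) : {poly R} := \poly_(a < m.+1) ('C(m, a)%:R * (e ^+ a * P a (m - a)%N)).
have pE e s : (p e).[s] = contrs (nseq m (fun i => (e * s) * y i + 1 * @ones R n i)) (wform h) [::].
  rewrite contrs_binomial // horner_poly; apply: eq_bigr => a _.
  by rewrite expr1n mulr1 exprMn /P; ring.
(* For [0 < s < b] both [1 + s y] and [1 - s y] are positive. *)
pose b : R := (1 + \sum_i `|y i|)^-1.
have yS i : `|y i| <= \sum_j `|y j| by rewrite (bigD1 i) //= lerDl sumr_ge0.
have S0 : 0 < 1 + \sum_i `|y i| by rewrite ltr_wpDr // sumr_ge0.
have b0 : 0 < b by rewrite invr_gt0.
(* The midpoint defect up to the factor [m!] squared; its coefficient of order two is
   [- 2 * 'C(m, 2) * P 0 m * bil Q y y]. *)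
pose q := (P 0%N m ^+ 2)%:P - p 1 * p (-1).
have : 0 <= q`_2.
  apply: (poly_limit b0) => [s s0 sb||].
  - have sy i : s * `|y i| < 1.
      apply: le_lt_trans (_ : s * (\sum_j `|y j|) < 1); first by rewrite ler_pM2l.
      apply: lt_le_trans (_ : s * (1 + \sum_j `|y j|) <= 1); first by rewrite ltr_pM2l // ltrDr.
      by rewrite -ler_pdivlMr // mul1r ltW.
    have pz e : e = 1 \/ e = -1 -> positive (fun i => (e * s) * y i + 1 * @ones R n i).
      move=> e1 i; rewrite /ones mulr1; have := sy i; have := ler_norm (y i).
      have := ler_norm (- y i); rewrite normrN; case: e1 => ->; nra.
    have := log_concave_midpoint hx0 hlc (pz 1 (or_introl erefl)) (pz (-1) (or_intror erefl)).
    rewrite [X in _ <= X ^+ 2](_ : _ = P 0%N m / m`!%:R); last first.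
      rewrite -[P 0%N m]/(contrs (nseq m (@ones R n)) (wform h) [::]) -hE; congr (h.@[_]).
      by apply: boolp.funext => i; rewrite /ones; field.
    rewrite !hE -!pE hornerD hornerN hornerM hornerC.
    rewrite (_ : _ * _ = (p 1).[s] * (p (-1)).[s] * m`!%:R^-1 ^+ 2); last ring.
    by rewrite exprMn ler_pM2r ?exprn_gt0 // subr_ge0.
  - rewrite coefB coefC coefM big_ord_recl big_ord0 /= !coef_poly /= bin0 subn0 !expr0; ring.
  - rewrite coefB coefC coefM !big_ord_recl big_ord0 /= /bump /= !coef_poly /=.
    rewrite ltnS (ltnW m2) bin0 bin1 subn0 P1; ring.
rewrite coefB coefC coefM !big_ord_recl big_ord0 /= /bump /= !coef_poly /= !ltnS m2 (ltnW m2).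
rewrite !bin0 !bin1 !subn0 /= P1 -P2.
have : 0 < ('C(m, 2)%:R : R) by rewrite ltr0n bin_gt0.
move: ('C(m, 2)%:R : R) (P 0%N m) Ap (bil Q y y) => M A A0' B M0 h2.
have {h2}h2 : 0 <= - (M * A * B) by nra.
have MA : 0 < M * A by rewrite mulr_gt0.
by rewrite oppr_ge0 pmulr_rle0 in h2.
Qed.

Theorem clc_criterion d g : g \is d.-homog -> (forall a, 0 <= g@_a) -> (2 <= d)%N ->
  completely_log_concave g <-> local_lorentz (d - 2) (wform g).
Proof.
move=> hg g0 d2; split; first exact: clc_local_lorentz.
move=> L; apply: (af_clc hg) => // _; apply: local_lorentz_af => //.
- exact: symw_wform.
- exact: wform_ge0.
Qed.

End Criterion.

(** * The test by elimination *)

Section Elimination.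
Variable R : realFieldType.
Implicit Types W : nat -> nat -> R.

(* If the pivot is 0, division by 0 gives 0 and the matrix is unchanged. *)
Definition schur W p i j := W i j - W i p * W p j / W p p.

Fixpoint elim W p := if p is p'.+1 then schur (elim W p') p' else W.

(** A zero diagonal entry of a semidefinite matrix forces its row to vanish, so a zero pivot can be
    passed over without reordering. *)
Definition pivot_ok W p j := (0 <= W p p) && ((W p p <= 0) ==> (W p j == 0)).

(** Matrices are functions on [nat], like the arrays of the machine; only the leading [n] by [n]
    block is read as a form. *)
Definition ordmx n W (i j : 'I_n) := W i j.

Lemma bil_delta n (H : 'I_n -> 'I_n -> R) (p : 'I_n) x :
  bil H (fun i => (i == p)%:R) x = \sum_j H p j * x j.
Proof.
rewrite /bil (bigD1 p) //= [X in _ + X]big1 ?addr0 => [|i /negPf ip].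
  by apply: eq_bigr => j _; rewrite eqxx mul1r.
by apply: big1 => j _; rewrite ip mul0r mulr0.
Qed.

Lemma sum_delta n (h : 'I_n -> R) (p : 'I_n) : \sum_j h j * (j == p)%:R = h p.
Proof.
by rewrite (bigD1 p) //= eqxx mulr1 big1 ?addr0 // => i /negPf ->; rewrite mulr0.
Qed.

Lemma bil_schur n W (p : 'I_n) x : sym2 (@ordmx n W) ->
  bil (@ordmx n (schur W p)) x x =
  bil (@ordmx n W) x x - (\sum_(j < n) W p j * x j) ^+ 2 / W p p.
Proof.
move=> sW; rewrite expr2 -mulrA mulr_suml /bil -sumrB; apply: eq_bigr => i _.
rewrite mulr_suml mulr_sumr -sumrB; apply: eq_bigr => j _.
rewrite /ordmx /schur (_ : W p i = W i p); last exact: (sW p i).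
by rewrite /ordmx; ring.
Qed.

(** Completing the square: for a nonzero pivot, the form of [schur W p] at [x] is the value of the
    form of [W] at [x + c e_p] for the minimizing [c]. *)
Lemma psd_schur n W (p : 'I_n) : sym2 (@ordmx n W) ->
  psd (@ordmx n W) <-> (forall j, (j < n)%N -> pivot_ok W p j) /\ psd (@ordmx n (schur W p)).
Proof.
move=> sW; split=> [P|[ok P] x]; last first.
  have := P x; rewrite bil_schur // subr_ge0; apply: le_trans.
  case/andP: (ok p (ltn_ord p)) => Wpp _.
  by rewrite divr_ge0 // sqr_ge0.
pose e (i : 'I_n) : 'I_n -> R := fun j => (j == i)%:R.
have We i j : bil (@ordmx n W) (e i) (e j) = W i j by rewrite bil_delta sum_delta.
have Wpp : 0 <= W p p by rewrite -We.
split=> [j jn|x].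
  rewrite /pivot_ok Wpp /=; apply/implyP => Wp.
  have W0 : W p p = 0 by apply/eqP; rewrite eq_le Wp.
  have := psd_cauchy (e p) (e (Ordinal jn)) sW P; rewrite !We W0 mul0r => h.
  by rewrite -sqrf_eq0 eq_le h sqr_ge0.
rewrite bil_schur //.
have [W0|W0] := eqVneq (W p p) 0; first by rewrite W0 invr0 mulr0 subr0.
pose c := - (\sum_(j < n) W p j * x j) / W p p.
have := P (fun i => 1 * x i + c * e p i); rewrite bil_comb2 // We (bilC x) // bil_delta.
by move/le_trans; apply; rewrite le_eqVlt; apply/orP; left; apply/eqP; rewrite /c; field.
Qed.

Lemma sym_elim n W p : (p <= n)%N -> sym2 (@ordmx n W) -> sym2 (@ordmx n (elim W p)).
Proof.
move=> pn sW; elim: p pn => //= p IH pn i j; have s := IH (ltnW pn).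
have si := s i (Ordinal pn); have sj := s j (Ordinal pn); have sij := s i j.
by rewrite /ordmx /= in si sj sij *; rewrite /schur si sj sij; ring.
Qed.

(** Finished rows are not removed but become zero. After [n] accepted pivots the matrix is zero,
    which starts the backward induction of [psd_elim]. *)
Lemma elim_rows0 n W p : (p <= n)%N ->
  (forall p' j, (p' < p)%N -> (j < n)%N -> pivot_ok (elim W p') p' j) ->
  forall i j, (i < p)%N -> (j < n)%N -> elim W p i j = 0.
Proof.
elim: p => //= p IH pn ok i j; rewrite ltnS leq_eqVlt => /orP[/eqP ->|ip] jn.
  have /andP[h1 /implyP h2] := ok p j (leqnn _) jn; rewrite /schur.
  have [W0|W0] := eqVneq (elim W p p p) 0; last by rewrite mulrAC divff // mul1r subrr.
  by move: h2; rewrite W0 lexx mul0r mul0r subr0 => /(_ isT) /eqP.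
have Z j' : (j' < n)%N -> elim W p i j' = 0.
  by apply: (IH (ltnW pn)) => // p' j'' p'p; apply: ok; apply: leqW.
by rewrite /schur !Z // mul0r mul0r subr0.
Qed.

Lemma psd_elim n W : sym2 (@ordmx n W) ->
  psd (@ordmx n W) <->
  (forall p j, (p < n)%N -> (j < n)%N -> pivot_ok (elim W p) p j).
Proof.
move=> sW.
have step p (pn : (p < n)%N) := psd_schur (Ordinal pn) (sym_elim (ltnW pn) sW).
split=> [P p j pn|ok].
  have Q q : (q <= n)%N -> psd (@ordmx n (elim W q)).
    by elim: q => // q IH qn; case/(step q qn): (IH (ltnW qn)).
  by case/(step p pn): (Q p (ltnW pn)) => h _; apply: h.
have Q k : (k <= n)%N -> psd (@ordmx n (elim W (n - k)%N)).
  elim: k => [_ x|k IH kn].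
    rewrite subn0 [bil _ _ _]big1 // => i _; apply: big1 => j _.
    by rewrite /ordmx (@elim_rows0 n W n) ?mul0r.
  have pn : (n - k.+1 < n)%N by lia.
  apply/(step _ pn); split=> [j jn|]; first exact: ok.
  by have := IH (ltnW kn); rewrite (_ : n - k = (n - k.+1).+1)%N //; lia.
by have := Q n (leqnn n); rewrite subnn.
Qed.

End Elimination.

(** * Partial sums of a form, indexed by codes of words *)

Section Tables.
Variables (R : realFieldType) (n d : nat) (F : seq 'I_n -> R) (G : nat -> R).
Hypotheses (sF : symw F) (F0 : forall u, 0 <= F u).

Definition code (w : seq 'I_n) : nat := foldl (fun q (i : 'I_n) => q * n + i)%N 0%N w.

(** Words are coded in base [n], so summing over a last digit plugs the all-ones vector into one
    slot. *)
Fixpoint fold_table (r q : nat) : R :=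
  if r is r'.+1 then \sum_(i < n) fold_table r' (q * n + i) else G q.

Definition table k := fold_table (d - k).

(** For the word coded by [q], levels [k], [k + 1] and [k + 2] of the table hold the total, the row
    sums and the entries of its matrix; this is the matrix of [lorentz_psd]. *)
Definition test_mx k q i j : R :=
  table k.+1 (q * n + i) * table k.+1 (q * n + j) - table k q * table k.+2 ((q * n + i) * n + j).

Lemma code_rcons w i : code (rcons w i) = (code w * n + i)%N.
Proof. by rewrite /code -cats1 foldl_cat. Qed.

Lemma code_lt w : (code w < n ^ size w)%N.
Proof.
elim/last_ind: w => [|w i IH] //; rewrite code_rcons size_rcons expnSr.
apply: leq_trans (_ : (code w).+1 * n <= _)%N; last by rewrite leq_mul2r IH orbT.
by rewrite mulSn addnC ltn_add2r.
Qed.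

Lemma code_surj k q : (q < n ^ k)%N -> exists w, size w = k /\ code w = q.
Proof.
elim: k q => [|k IH] q; first by rewrite expn0 ltnS leqn0 => /eqP ->; exists [::].
move=> qn; have n0 : (0 < n)%N by rewrite lt0n; apply: contraTneq qn => ->; rewrite exp0n.
have [|w [sw cw]] := IH (q %/ n)%N; first by rewrite ltn_divLR // -expnSr.
exists (rcons w (Ordinal (ltn_pmod q n0))); rewrite size_rcons sw code_rcons cw.
by rewrite -divn_eq.
Qed.

Hypothesis GF : forall w, size w = d -> G (code w) = F w.

Lemma fold_tableE r w : (size w + r = d)%N ->
  fold_table r (code w) = contrs (nseq r (@ones R n)) F w.
Proof.
elim: r w => [|r IH] w; first by rewrite addn0 => /GF.
move=> e; rewrite /= /contr; apply: eq_bigr => i _.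
rewrite -code_rcons IH ?size_rcons ?addSnnS // mul1r; apply: (symw_contrs _ sF).
by rewrite perm_rcons.
Qed.

Lemma local_lorentz_table : (2 <= d)%N ->
  local_lorentz (d - 2) F <->
  (forall k q p j, (k <= d - 2)%N -> (q < n ^ k)%N -> (p < n)%N -> (j < n)%N ->
     pivot_ok (elim (test_mx k q) p) p j).
Proof.
move=> d2.
suff key w : (size w <= d - 2)%N ->
  lorentz (quad (contrs (nseq (d - 2 - size w) (@ones R n)) (prefix_word w F))) (@ones R n) <->
  (forall p j, (p < n)%N -> (j < n)%N ->
     pivot_ok (elim (test_mx (size w) (code w)) p) p j).
  split=> [L k q p j kd qn|L w sw].
    have [w [sw cw]] := code_surj qn; move: kd; rewrite -sw -cw => kd.
    by move: p j; apply/key => //; apply: L.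
  by apply/key => // p j; apply: L => //; apply: code_lt.
move=> sw; set k := size w in sw *.
set Q := quad _.
have QE i j : Q i j = table k.+2 ((code w * n + i) * n + j)%N.
  rewrite -!code_rcons /table fold_tableE ?size_rcons -/k; last by lia.
  rewrite /Q /quad -prefix_word_contrs // (_ : d - k.+2 = d - 2 - k)%N; last by lia.
  by rewrite /prefix_word -!cats1 -catA.
have sP : symw (prefix_word w F) by exact: symw_prefix_word.
have sQ : sym2 Q by exact/sym2_quad/symw_contrs.
have Q1 i : \sum_j Q i j * @ones R n j = table k.+1 (code w * n + i)%N.
  rewrite /table (_ : d - k.+1 = (d - k.+2).+1)%N /=; last by lia.
  by apply: eq_bigr => j _; rewrite mulr1 QE.
have Q2 : bil Q (@ones R n) (@ones R n) = table k (code w).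
  rewrite /table (_ : d - k = (d - k.+1).+1)%N /=; last by lia.
  apply: eq_bigr => i _; rewrite -[fold_table _ _]Q1; apply: eq_bigr => j _.
  by rewrite /ones !mulr1.
have Q0 i j : 0 <= Q i j.
  by rewrite /Q; apply: contrs_ge0 => [|u]; [exact/every_nseq/vnneg_ones|exact: F0].
have TE : @ordmx R n (test_mx k (code w)) =2
    (fun i j => (\sum_k Q i k * @ones R n k) * (\sum_k Q j k * @ones R n k)
                - bil Q (@ones R n) (@ones R n) * Q i j).
  by move=> i j; rewrite /ordmx /test_mx !Q1 Q2 QE.
have sT : sym2 (@ordmx R n (test_mx k (code w))).
  by move=> i j; rewrite !TE sQ [X in X - _]mulrC.
rewrite -psd_elim //.
have -> : psd (@ordmx R n (test_mx k (code w))) <-> psd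
    (fun i j => (\sum_k Q i k * @ones R n k) * (\sum_k Q j k * @ones R n k)
                - bil Q (@ones R n) (@ones R n) * Q i j).
  have E x : bil (@ordmx R n (test_mx k (code w))) x x = bil (fun i j =>
      (\sum_k Q i k * @ones R n k) * (\sum_k Q j k * @ones R n k)
                - bil Q (@ones R n) (@ones R n) * Q i j) x x.
    by apply: eq_bigr => i _; apply: eq_bigr => j _; rewrite TE.
  by split=> P x; have := P x; rewrite E.
(* [lorentz_psd] needs a nonzero total; a zero total makes [Q] zero, and then both sides hold. *)
have [Z|Z] := eqVneq (bil Q (@ones R n) (@ones R n)) 0; last first.
  apply: lorentz_psd => //; rewrite /bil; apply: sumr_ge0 => i _; apply: sumr_ge0 => j _.
  by rewrite mulr_ge0 // /ones mulr1.
have Q11 i j : 0 <= Q i j * (@ones R n i * @ones R n j) by rewrite mulr_ge0 // /ones mulr1.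
have Qz i j : Q i j = 0 by have := sum2_ge0_eq0 Q11 Z i j; rewrite /ones !mulr1.
split=> [_ x|_ y _].
  apply: sumr_ge0 => i _; apply: sumr_ge0 => j _.
  by rewrite Qz mulr0 subr0 big1 ?mul0r ?mul0r // => l _; rewrite Qz mul0r.
by rewrite [bil _ _ _]big1 // => i _; apply: big1 => j _; rewrite Qz mul0r.
Qed.

End Tables.

(** * Running programs *)

Local Open Scope nat_scope.

Fixpoint nat_writes (c : cmd) : seq nat :=
  match c with
  | Skip | RSet _ _ _ => [::]
  | NSet a _ _ => [:: a]
  | Seq c1 c2 | If _ c1 c2 => nat_writes c1 ++ nat_writes c2
  | While _ c1 => nat_writes c1
  end.

Fixpoint real_writes (c : cmd) : seq nat :=
  match c with
  | Skip | NSet _ _ _ => [::]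
  | RSet a _ _ => [:: a]
  | Seq c1 c2 | If _ c1 c2 => real_writes c1 ++ real_writes c2
  | While _ c1 => real_writes c1
  end.

(* If every loop of c runs at most N^a times, with a summed along nested loops
   to at most b, then c takes time at most [cost_const c * N ^ b]. *)
Fixpoint cost_const (c : cmd) : nat :=
  match c with
  | Skip => 1
  | NSet _ e v => (ncost e + ncost v).+1
  | RSet _ e v => (ncost e + rcost v).+1
  | Seq c1 c2 => cost_const c1 + cost_const c2
  | If b c1 c2 => (bcost b + (cost_const c1 + cost_const c2)).+1
  | While b c1 => cost_const c1 + ((bcost b).+1 + (bcost b).+1)
  end.

Definition NVar (a : nat) : nexpr := NGet a (NConst 0).

Definition For (a : nat) (e : nexpr) (c : cmd) : cmd :=
  Seq (NSet a (NConst 0) (NConst 0))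
    (While (BNle (NAdd (NVar a) (NConst 1)) e)
       (Seq c (NSet a (NConst 0) (NAdd (NVar a) (NConst 1))))).

(** The cost of [For]: 3 is the initialization of the counter, 6 its increment, [G] one evaluation
    of the guard, which happens once more than the body. *)
Lemma loop_cost N X M C G : 0 < M -> 0 < X -> N <= X ->
  3 + (N * (C * M + 6 + G) + G) <= (3 + (C + 6 + (G + G))) * (X * M).
Proof.
move=> M0 X0 NX.
have h1 : N * (C * M + 6 + G) <= X * ((C + 6 + G) * M).
  by apply: leq_mul => //; rewrite !mulnDl !leq_add // leq_pmulr.
have h2 : 3 + G <= (3 + G) * (X * M) by rewrite leq_pmulr // muln_gt0 X0.
rewrite addnCA; apply: leq_trans (leq_add h1 h2) _.
by rewrite mulnCA -mulnDl leq_mul2r; apply/orP; right; lia.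
Qed.

(** * Total correctness with time bounds *)

Section Logic.
Variables (R : realType) (n : nat).
Implicit Types (s : state R) (c : cmd).

(** A syntactic scan of the writes, so that invariants need not mention cells that a command never
    touches. *)
Definition frame c s s' :=
  (forall a i, a \notin nat_writes c -> nats s' a i = nats s a i) /\
  (forall a i, a \notin real_writes c -> rels s' a i = rels s a i).

Lemma exec_frame c s t s' : exec c s t s' -> frame c s s'.
Proof.
elim=> {c s t s'}.
- by [].
- move=> a e v s; split=> //= b i; rewrite inE /update => /negPf ->; by [].
- move=> a e v s; split=> //= b i; rewrite inE /update => /negPf ->; by [].
- move=> c1 c2 s t1 s1 t2 s2 _ [n1 r1] _ [n2 r2]; split=> a i /=;
    rewrite mem_cat negb_or => /andP[h1 h2]; by rewrite ?n2 ?n1 ?r2 ?r1.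
- move=> b c1 c2 s t s1 _ [n1 r1]; split=> a i /=;
    rewrite mem_cat negb_or => /andP[h1 h2]; [apply: n1|apply: r1]; by case: ifP.
- by [].
- move=> b c s t1 s1 t2 s2 _ _ [n1 r1] _ [n2 r2]; split=> a i /= h; by rewrite ?n2 ?n1 ?r2 ?r1.
Qed.

(* Only cells (0, 0) and (2, 0) of the natural memory, the answer and the input
   pointer, and the real memory carry data from one phase to the next. *)
Definition post := nat -> nat -> (nat -> nat -> R) -> Prop.

Definition holds (Q : post) s := Q (nats s 0 0) (nats s 2 0) (rels s).

(** [maxn n 1] keeps the bound positive at [n = 0], where commands still take time. *)
Definition runs c s (b : nat) (Q : post) :=
  exists t s', [/\ exec c s t s', t <= cost_const c * maxn n 1 ^ b & holds Q s'].

Lemma expn_max_gt0 b : 0 < maxn n 1 ^ b.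
Proof. by rewrite expn_gt0 leq_max orbT. Qed.

Lemma leq_expn_max a b : a <= b -> maxn n 1 ^ a <= maxn n 1 ^ b.
Proof. by move=> ab; rewrite leq_pexp2l // leq_max orbT. Qed.

Lemma runs_weak c s b b' (Q Q' : post) : b <= b' ->
  (forall f p r, Q f p r -> Q' f p r) -> runs c s b Q -> runs c s b' Q'.
Proof.
move=> bb QQ [t [s' [E T H]]]; exists t, s'; split=> //; last exact: QQ.
by apply: leq_trans T _; rewrite leq_mul2l leq_expn_max ?orbT.
Qed.

Lemma runs_skip s b (Q : post) : holds Q s -> runs Skip s b Q.
Proof. by move=> H; exists 1, s; split=> //; [exact: exec_skip|rewrite mul1n expn_max_gt0]. Qed.

Lemma runs_nset a e v s b (Q : post) :
  holds Q (State (update (nats s) a (neval s e) (neval s v)) (rels s)) ->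
  runs (NSet a e v) s b Q.
Proof.
move=> H; eexists _, _; split; [exact: exec_nset| |exact: H].
by rewrite leq_pmulr // expn_max_gt0.
Qed.

Lemma runs_rset a e v s b (Q : post) :
  Q (nats s 0 0) (nats s 2 0) (update (rels s) a (neval s e) (reval s v)) ->
  runs (RSet a e v) s b Q.
Proof.
move=> H; eexists _, _; split; [exact: exec_rset| |exact: H].
by rewrite leq_pmulr // expn_max_gt0.
Qed.

Lemma runs_seq c1 c2 s b (Q1 Q : post) : runs c1 s b Q1 ->
  (forall s1, holds Q1 s1 -> frame c1 s s1 -> runs c2 s1 b Q) ->
  runs (Seq c1 c2) s b Q.
Proof.
move=> [t1 [s1 [E1 T1 H1]]] /(_ s1 H1 (exec_frame E1)) [t2 [s2 [E2 T2 H2]]].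
exists (t1 + t2), s2; split=> //; first exact: exec_seq E1 E2.
by rewrite /= mulnDl leq_add.
Qed.

Lemma runs_if e c1 c2 s b (Q : post) :
  (beval s e -> runs c1 s b Q) -> (~~ beval s e -> runs c2 s b Q) ->
  runs (If e c1 c2) s b Q.
Proof.
move=> h1 h2.
have [t [s' [E T H]]] : exists t s', [/\ exec (if beval s e then c1 else c2) s t s',
   t <= (cost_const c1 + cost_const c2) * maxn n 1 ^ b & holds Q s'].
  case: ifP => [/h1|/negbT/h2] [t [s' [E T H]]]; exists t, s'; split=> //;
    by apply: leq_trans T _; rewrite leq_mul2r ?leq_addr ?leq_addl orbT.
exists (bcost e + t).+1, s'; split=> //; first exact: exec_if.
rewrite /= -!addSn mulnDl leq_add // leq_pmulr //; exact: expn_max_gt0.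
Qed.

(** Exponents add along nested loops. The counter is neither written by the body nor visible to
    [post], so resetting or incrementing it preserves the invariant. *)
Lemma runs_for a e c s (N x b : nat) (J : nat -> post) :
  a \notin 0 :: 2 :: nat_writes c -> N <= maxn n 1 ^ x ->
  (forall s1, frame (For a e c) s s1 -> neval s1 e = N) ->
  holds (J 0) s ->
  (forall i s1, i < N -> holds (J i) s1 -> nats s1 a 0 = i -> frame (For a e c) s s1 ->
     runs c s1 b (J i.+1)) ->
  runs (For a e c) s (x + b) (J N).
Proof.
rewrite !inE !negb_or => /and3P[a0 a2 ac] NX hN J0 hc.
pose M := maxn n 1 ^ b; pose inc := NSet a (NConst 0) (NAdd (NVar a) (NConst 1)).
pose g := BNle (NAdd (NVar a) (NConst 1)) e.
pose W := While g (Seq c inc).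
have obs s1 v Q : holds Q s1 -> holds Q (State (update (nats s1) a 0 v) (rels s1)).
  have e0 y : y != a -> update (nats s1) a 0 v y 0 = nats s1 y 0 by rewrite /update => /negPf ->.
  move=> h; change (Q (update (nats s1) a 0 v 0 0) (update (nats s1) a 0 v 2 0) (rels s1)).
  by rewrite !e0 // eq_sym.
have fr s1 s2 c1 : (forall y, y \in nat_writes c1 -> y \in a :: nat_writes c) ->
    (forall y, y \in real_writes c1 -> y \in real_writes c) ->
    frame (For a e c) s s1 -> frame c1 s1 s2 -> frame (For a e c) s s2.
  move=> w1 w2 [f1 f2] [g1 g2]; split=> y i yc.
    rewrite g1 ?f1 //; apply: contra yc => /w1.
    by rewrite /= !inE mem_cat => /orP[->|->]; rewrite ?orbT.
  rewrite g2 ?f2 //; apply: contra yc => /w2; by rewrite /= cats0.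
have loop r i s1 : i + r = N -> holds (J i) s1 -> nats s1 a 0 = i ->
    frame (For a e c) s s1 -> exists t s', [/\ exec W s1 t s',
      t <= r * (cost_const c * M + 6 + (bcost g).+1) + (bcost g).+1 & holds (J N) s'].
  elim: r i s1 => [|r IH] i s1 iN Ji s1i f1.
    exists (bcost g).+1, s1; split; rewrite ?mul0n ?add0n //.
      by apply: exec_while_stop; rewrite /= s1i hN //; apply/negbTE; lia.
    by rewrite -iN addn0.
  have iN' : i < N by lia.
  have [t1 [s2 [E1 T1 H1]]] := hc i s1 iN' Ji s1i f1.
  have f2 := exec_frame E1.
  have s2i : nats s2 a 0 = i by rewrite f2.1.
  pose s3 := State (update (nats s2) a 0 i.+1) (rels s2).
  have E3 : exec inc s2 6 s3.
    have -> : s3 = State (update (nats s2) a (neval s2 (NConst 0))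
        (neval s2 (NAdd (NVar a) (NConst 1)))) (rels s2) by rewrite /= s2i addn1.
    exact: exec_nset.
  have [||||t [s' [E T H]]] := IH i.+1 s3; rewrite ?addSnnS //.
  - exact: obs.
  - by rewrite /s3 /= /update !eqxx.
  - apply: fr (_ : frame (Seq c inc) s1 s3) => //.
    + by move=> y /=; rewrite mem_cat !inE orbC.
    + by move=> y /=; rewrite cats0.
    + exact: exec_frame (exec_seq E1 E3).
  exists (bcost g + (t1 + 6) + t).+1, s'; split=> //.
    apply: exec_while_loop E; last exact: exec_seq E1 E3.
    by rewrite /= s1i hN //; lia.
  by move: T T1; rewrite -/M; move: (_ * M) => K; lia.
pose s1 := State (update (nats s) a 0 0) (rels s).
have E1 : exec (NSet a (NConst 0) (NConst 0)) s 3 s1 by exact: exec_nset.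
have [||||t [s' [E T H]]] := loop N 0 s1; rewrite ?add0n //.
- exact: obs.
- by rewrite /s1 /= /update !eqxx.
- have [f1 f2] := exec_frame E1; split=> y i yc; last exact: f2.
  by apply: f1; apply: contra yc; rewrite /= !inE => ->.
exists (3 + t), s'; split=> //; first exact: exec_seq E1 E.
apply: leq_trans (leq_add (leqnn 3) T) _.
rewrite expnD; apply: (@loop_cost N _ M (cost_const c) (bcost g).+1) => //; exact: expn_max_gt0.
Qed.

End Logic.

Local Open Scope ring_scope.

(** * The decision program *)

(** Natural array 1 holds a copy of [n], since cell 0 of array 0 is overwritten by the answer. *)
Fixpoint NPow (k : nat) : nexpr := if k is k'.+1 then NMul (NPow k') (NVar 1) else NConst 1.

Definition NIdx (a e : nexpr) : nexpr := NAdd (NMul a (NVar 1)) e.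

(* Real array 3 + k holds [table k]. *)
Definition fold_level (k : nat) : cmd :=
  For 3 (NPow k)
    (Seq (RSet (3 + k) (NVar 3) (RConst 0))
      (For 4 (NVar 1)
        (RSet (3 + k) (NVar 3)
          (RAdd (RGet (3 + k) (NVar 3)) (RGet (4 + k) (NIdx (NVar 3) (NVar 4))))))).

Fixpoint fold_levels (k : nat) : cmd :=
  if k is k'.+1 then Seq (fold_level k') (fold_levels k') else Skip.

(* Layer l of real array 2 holds the matrix [elim _ l], entry (i, j) in cell
   (l n + i) n + j. *)
Definition fill (layer : nexpr) (v : rexpr) : cmd :=
  For 4 (NVar 1) (For 5 (NVar 1)
    (RSet 2 (NIdx (NIdx layer (NVar 4)) (NVar 5)) v)).

Definition entry (layer i j : nexpr) : rexpr := RGet 2 (NIdx (NIdx layer i) j).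

Definition test_entry (k : nat) : rexpr :=
  RSub (RMul (RGet (4 + k) (NIdx (NVar 3) (NVar 4))) (RGet (4 + k) (NIdx (NVar 3) (NVar 5))))
    (RMul (RGet (3 + k) (NVar 3)) (RGet (5 + k) (NIdx (NIdx (NVar 3) (NVar 4)) (NVar 5)))).

Definition schur_entry : rexpr :=
  RSub (entry (NVar 6) (NVar 4) (NVar 5))
    (RDiv (RMul (entry (NVar 6) (NVar 4) (NVar 6)) (entry (NVar 6) (NVar 6) (NVar 5)))
       (entry (NVar 6) (NVar 6) (NVar 6))).

Definition pivot_test : bexpr :=
  let p := entry (NVar 6) (NVar 6) (NVar 6) in
  let r := entry (NVar 6) (NVar 6) (NVar 4) in
  BAnd (BRle (RConst 0) p)
    (BNot (BAnd (BRle p (RConst 0)) (BNot (BAnd (BRle r (RConst 0)) (BRle (RConst 0) r))))).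

Definition check_pivot : cmd :=
  For 4 (NVar 1) (If pivot_test Skip (NSet 0 (NConst 0) (NConst 0))).

(** Each elimination step writes a new layer, so the pivot row and column stay intact while they are
    read. A failed test does not stop the run; division by a zero pivot is harmless. *)
Definition check_matrix (k : nat) : cmd :=
  Seq (fill (NConst 0) (test_entry k))
    (For 6 (NVar 1) (Seq check_pivot (fill (NAdd (NVar 6) (NConst 1)) schur_entry))).

Definition check_level (k : nat) : cmd := For 3 (NPow k) (check_matrix k).

Fixpoint check_levels (k : nat) : cmd :=
  if k is k'.+1 then Seq (check_levels k') (check_level k') else Skip.

Lemma all_iota_rcons (P : pred nat) i : all P (iota 0 i.+1) = all P (iota 0 i) && P i.
Proof. by rewrite -addn1 iotaD all_cat /= andbT. Qed.

Definition matrix_ok (R : realFieldType) n (M : nat -> nat -> R) :=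
  all (fun p => all (pivot_ok (elim M p) p) (iota 0 n)) (iota 0 n).

Definition loaded_mx (R : realType) n (r : nat -> nat -> R) k q i j : R :=
  r (4 + k)%N (q * n + i)%N * r (4 + k)%N (q * n + j)%N
  - r (3 + k)%N q * r (5 + k)%N ((q * n + i) * n + j)%N.

(** * The summation and elimination phases *)

Section Phases.
Variables (R : realType) (n : nat).
Implicit Types (s : state R) (r : nat -> nat -> R).

Lemma neval_pow s k : nats s 1 0 = n -> neval s (NPow k) = (n ^ k)%N.
Proof. by move=> sn; elim: k => //= k ->; rewrite sn expnSr. Qed.

Lemma update_same (T : Type) (m : nat -> nat -> T) a i v : update m a i v a i = v.
Proof. by rewrite /update !eqxx. Qed.

Lemma update_array (T : Type) (m : nat -> nat -> T) a i v b j :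
  b != a -> update m a i v b j = m b j.
Proof. by rewrite /update => /negPf ->. Qed.

Lemma update_cell (T : Type) (m : nat -> nat -> T) a i v b j :
  j != i -> update m a i v b j = m b j.
Proof. by rewrite /update => /negPf ->; rewrite andbF. Qed.

Lemma leq_max1_pow k : (n ^ k <= maxn n 1 ^ k)%N.
Proof. by case: k => // k; rewrite leq_exp2r // leq_maxl. Qed.

Lemma runs_fold_level k s : nats s 1 0 = n ->
  runs n (fold_level k) s (k + 1) (fun f p r =>
    [/\ f = nats s 0 0, p = nats s 2 0,
        forall a x, a != (3 + k)%N -> r a x = rels s a x &
        forall q, (q < n ^ k)%N -> r (3 + k)%N q = \sum_(i < n) rels s (4 + k)%N (q * n + i)%N]).
Proof.
move=> sn.
have k4 : (4 + k != 3 + k)%N by rewrite eqn_add2r.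
pose J0 q f p r := [/\ f = nats s 0 0, p = nats s 2 0,
  forall a x, a != (3 + k)%N -> r a x = rels s a x &
  forall q', (q' < q)%N -> r (3 + k)%N q' = \sum_(i < n) rels s (4 + k)%N (q' * n + i)%N].
apply: (@runs_for R n _ _ _ s (n ^ k) k 1 J0) => //; first exact: leq_max1_pow.
  by move=> s1 [f1 _]; rewrite neval_pow // f1.
move=> q s1 qn [s0f s0p s0a s0t] s1q [f1 _].
have s1n : nats s1 1 0 = n by rewrite f1.
pose J1 i f p r := [/\ f = nats s 0 0, p = nats s 2 0,
  forall a x, a != (3 + k)%N -> r a x = rels s a x,
  forall q', (q' < q)%N -> r (3 + k)%N q' = \sum_(i < n) rels s (4 + k)%N (q' * n + i)%N &
  r (3 + k)%N q = \sum_(j < n | (j < i)%N) rels s (4 + k)%N (q * n + j)%N].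
apply: (@runs_seq R n _ _ _ _ (J1 0%N)).
  apply: runs_rset; rewrite /= s1q; split=> //.
  - by move=> a x ak; rewrite update_array // s0a.
  - by move=> q' qq; rewrite update_cell ?s0t // ltn_eqF.
  - by rewrite update_same big_pred0.
move=> s2 H2 [f2 _].
have s2q : nats s2 3 0 = q by rewrite f2.
have s2n : nats s2 1 0 = n by rewrite f2.
apply: (@runs_weak R n _ _ (1 + 0) _ (J1 n)) => // [f p r [-> -> h1 h2 h3]|].
  split=> // q'; rewrite ltnS leq_eqVlt => /orP[/eqP ->|/h2 //].
  by rewrite h3; apply: eq_bigl => j; rewrite ltn_ord.
apply: (@runs_for R n _ _ _ s2 n 1 0 J1) => //; first by rewrite expn1 leq_maxl.
  by move=> s3 [f3 _] /=; rewrite f3.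
move=> i s3 ni [h1 h2 h3 h4 h5] s3i [f3 _].
have s3q : nats s3 3 0 = q by rewrite f3.
have s3n : nats s3 1 0 = n by rewrite f3.
apply: runs_rset; rewrite /= s3q s3n s3i; split=> //.
- by move=> a x ak; rewrite update_array // h3.
- by move=> q' qq; rewrite update_cell ?h4 // ltn_eqF.
- rewrite update_same h5 h3 // [RHS](bigD1 (Ordinal ni)) //= addrC; congr (_ + _).
  by apply: eq_bigl => j; rewrite ltnS -val_eqE /= ltn_neqAle andbC.
Qed.

Lemma runs_fold_levels d k s : nats s 1 0 = n -> (k <= d)%N ->
  (forall l q, (k <= l <= d)%N -> (q < n ^ l)%N ->
     rels s (3 + l)%N q = table n d (rels s (3 + d)%N) l q) ->
  runs n (fold_levels k) s k (fun f p r =>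
    [/\ f = nats s 0 0, p = nats s 2 0 &
        forall l q, (l <= d)%N -> (q < n ^ l)%N ->
          r (3 + l)%N q = table n d (rels s (3 + d)%N) l q]).
Proof.
elim: k s => [|k IH] s sn kd T; first by apply: runs_skip; split=> // l q ld; apply: T.
apply: runs_seq.
  by apply: runs_weak (runs_fold_level k sn) => [|f p r H]; [rewrite addn1|exact: H].
move=> s1 [h1 h2 h3 h4] [f1 _].
have s1n : nats s1 1 0 = n.
  by rewrite f1 // /= !inE.
have E : rels s1 (3 + d)%N =1 rels s (3 + d)%N.
  by move=> x; rewrite h3 // eqn_add2l gtn_eqF.
have TE l q : table n d (rels s1 (3 + d)%N) l q = table n d (rels s (3 + d)%N) l q.
  rewrite /table; elim: (d - l)%N q => [|m IHm] q; first exact: E.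
  by apply: eq_bigr => i _; apply: IHm.
have [|||t [s' [X1 X2 [X3 X4 X5]]]] := IH s1 => //; first exact: ltnW.
  move=> l q /andP[]; rewrite leq_eqVlt => /orP[/eqP <- _|kl ld] qn; rewrite TE.
    rewrite h4 // /table -subSS (_ : d.+1 - k.+1 = (d - k.+1).+1)%N; last by lia.
    apply: eq_bigr => i _; apply: T; first by rewrite leqnn.
    rewrite expnSr; apply: leq_trans (_ : q.+1 * n <= _)%N; last by rewrite leq_mul2r qn orbT.
    by rewrite mulSn addnC ltn_add2r.
  by rewrite h3 ?T ?kl // eqn_add2l gtn_eqF.
exists t, s'; split=> //.
  by apply: leq_trans X2 _; rewrite leq_mul2l leq_expn_max ?orbT.
by split=> [||l q ld qn]; rewrite ?X3 ?X4 // X5 // TE.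
Qed.

(** Layer [L] occupies addresses from [L * n * n] on, so [v] may read the layers below it during the
    writing. *)
Lemma runs_fill layer v s L (val : nat -> nat -> R) :
  nats s 1 0 = n -> (forall s1, frame (fill layer v) s s1 -> neval s1 layer = L) ->
  (forall s1 i j, frame (fill layer v) s s1 -> (i < n)%N -> (j < n)%N ->
     nats s1 4 0 = i -> nats s1 5 0 = j ->
     (forall x, (x < L * n * n)%N -> rels s1 2 x = rels s 2 x) -> reval s1 v = val i j) ->
  runs n (fill layer v) s 2 (fun f p r =>
    [/\ f = nats s 0 0, p = nats s 2 0, forall a x, a != 2 -> r a x = rels s a x &
        forall i j, (i < n)%N -> (j < n)%N -> r 2 ((L * n + i) * n + j)%N = val i j]).
Proof.
move=> sn hL hv.
pose J c f p r := [/\ f = nats s 0 0, p = nats s 2 0, forall a x, a != 2 -> r a x = rels s a x,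
   forall x, (x < L * n * n)%N -> r 2 x = rels s 2 x &
   forall i j, (i < n)%N -> (j < n)%N -> (i * n + j < c)%N ->
     r 2 ((L * n + i) * n + j)%N = val i j].
apply: (@runs_weak R n _ _ (1 + 1) _ (J (n * n)%N)) => // [f p r [-> -> h1 _ h2]|].
  split=> // i j ni nj; apply: h2 => //.
  by apply: leq_trans (_ : i.+1 * n <= _)%N; [rewrite mulSn addnC ltn_add2r|rewrite leq_mul2r ni orbT].
apply: (@runs_for R n _ _ _ s n 1 1 (fun i => J (i * n)%N)) => //.
- by rewrite expn1 leq_maxl.
- by move=> s1 [f1 _] /=; rewrite f1.
move=> i s1 ni H1 s1i fr1.
have s1n : nats s1 1 0 = n by rewrite fr1.1.
apply: (@runs_weak R n _ _ (1 + 0) _ (J (i * n + n)%N)) => // [f p r|].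
  by rewrite mulSn addnC.
apply: (@runs_for R n _ _ _ s1 n 1 0 (fun j => J (i * n + j)%N)) => //.
- by rewrite expn1 leq_maxl.
- by move=> s2 [f2 _] /=; rewrite f2.
- by rewrite addn0.
move=> j s2 nj [h1 h2 h3 h4 h5] s2j fr2.
have s2i : nats s2 4 0 = i by rewrite fr2.1.
have s2n : nats s2 1 0 = n by rewrite fr2.1.
have fr : frame (fill layer v) s s2.
  split=> a x /=; rewrite !inE => ha; [rewrite fr2.1 ?fr1.1|rewrite fr2.2 ?fr1.2] => //;
    by move: ha; rewrite /= !inE; do ?case: eqP.
apply: runs_rset; rewrite /= s2i s2j s2n hL // (hv s2 i j) //; split=> //.
- by move=> a x a2; rewrite update_array ?h3.
- move=> x xL; rewrite update_cell ?h4 // ltn_eqF // (leq_trans xL) //.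
  by rewrite mulnDl -addnA leq_addr.
- move=> i' j' ni' nj'; rewrite addnS ltnS leq_eqVlt => /orP[/eqP e|lt].
    have n0 : (0 < n)%N by exact: leq_ltn_trans nj.
    (* Quotient and remainder by [n] recover the indices from the address. *)
    have -> : i' = i by have := congr1 (divn^~ n) e; rewrite !divnMDl // !divn_small // !addn0.
    have -> : j' = j by have := congr1 (modn^~ n) e; rewrite !modnMDl !modn_small.
    by rewrite update_same.
  rewrite update_cell ?h5 //; apply/negP => /eqP e'.
  by move: lt; rewrite ltnNge => /negP; apply; move: e'; rewrite !mulnDl; lia.
Qed.

Lemma runs_check_pivot s W p (b : bool) : (p < n)%N -> nats s 1 0 = n -> nats s 6 0 = p ->
  nats s 0 0 = b ->
  (forall i j, (i < n)%N -> (j < n)%N -> rels s 2 ((p * n + i) * n + j)%N = W i j) ->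
  runs n check_pivot s 1 (fun f ptr r =>
    [/\ f = b && all (pivot_ok W p) (iota 0 n), ptr = nats s 2 0 & r = rels s]).
Proof.
move=> pn sn sp sb sW.
pose J i (f ptr : nat) (r : nat -> nat -> R) :=
  [/\ f = b && all (pivot_ok W p) (iota 0 i), ptr = nats s 2 0 & r = rels s].
apply: (@runs_weak R n _ _ (1 + 0) _ (J n)) => //.
apply: (@runs_for R n _ _ _ s n 1 0 J) => //.
- by rewrite expn1 leq_maxl.
- by move=> s1 [f1 _] /=; rewrite f1.
- by split; rewrite // andbT.
move=> i s1 ni [h1 h2 h3] s1i [f1 _].
have T : beval s1 pivot_test = pivot_ok W p i.
  rewrite /= /pivot_ok; have -> : nats s1 1 0 = n by rewrite f1.
  have -> : nats s1 6 0 = p by rewrite f1.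
  by rewrite s1i h3 !sW // negb_and negbK -eq_le implybE.
apply: runs_if; rewrite T => ok; [apply: runs_skip|apply: runs_nset]; split=> //.
- by rewrite h1 all_iota_rcons ok andbT.
- by rewrite all_iota_rcons (negPf ok) !andbF.
Qed.

Lemma runs_check_matrix s k q (b : bool) : nats s 1 0 = n -> nats s 3 0 = q -> nats s 0 0 = b ->
  runs n (check_matrix k) s 3 (fun f ptr r =>
    [/\ f = b && matrix_ok n (loaded_mx n (rels s) k q), ptr = nats s 2 0 &
        forall a x, a != 2 -> r a x = rels s a x]).
Proof.
move=> sn sq sb; set M := loaded_mx n (rels s) k q.
apply: runs_seq.
  apply: (@runs_weak R n _ _ 2 3 _ _ isT (fun f p r H => H)).
  apply: (@runs_fill _ _ s 0%N M) => // s1 i j [f1 f2] ni nj s1i s1j _.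
  have s1n : nats s1 1 0 = n by rewrite f1.
  have s1q : nats s1 3 0 = q by rewrite f1.
  by rewrite /= s1i s1j s1n s1q !f2.
move=> s1 [h1 h2 h3 h4] [f1 f2].
pose J p (f ptr : nat) (r : nat -> nat -> R) := [/\ f = b && all (fun p' => all (pivot_ok (elim M p') p') (iota 0 n)) (iota 0 p),
  ptr = nats s 2 0, forall a x, a != 2 -> r a x = rels s a x &
  forall i j, (i < n)%N -> (j < n)%N -> r 2 ((p * n + i) * n + j)%N = elim M p i j].
have s1n : nats s1 1 0 = n by rewrite f1.
apply: (@runs_weak R n _ _ (1 + 2) _ (J n)) => // [f p r []//|].
apply: (@runs_for R n _ _ _ s1 n 1 2 J) => //.
- by rewrite expn1 leq_maxl.
- by move=> s2 [g1 _] /=; rewrite g1.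
- by split=> //; rewrite h1 sb andbT.
move=> p s2 np [e1 e2 e3 e4] s2p [g1 _].
have s2n : nats s2 1 0 = n by rewrite g1.
apply: runs_seq.
  apply: (@runs_weak R n _ _ 1 2 _ _ isT (fun f p r H => H)).
  exact: (runs_check_pivot np s2n s2p e1 e4).
move=> s3 [k1 k2 k3] [l1 _].
have s3n : nats s3 1 0 = n by rewrite l1.
have s3p : nats s3 6 0 = p by rewrite l1.
apply: (runs_weak (leqnn _) _ (@runs_fill _ _ s3 p.+1 (schur (elim M p) p) s3n _ _)) => [f ptr r [x1 x2 x3 x4]||].
- split=> //; first by rewrite x1 k1 all_iota_rcons andbA.
  + by rewrite x2 k2.
  + by move=> a x a2; rewrite x3 // k3 e3.
- by move=> s4 [m1 _] /=; rewrite m1 // s3p addn1.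
move=> s4 i j [m1 m2] ni nj s4i s4j lo.
have s4n : nats s4 1 0 = n by rewrite m1.
have s4p : nats s4 6 0 = p by rewrite m1.
have rd i' j' : (i' < n)%N -> (j' < n)%N -> rels s4 2 ((p * n + i') * n + j')%N = elim M p i' j'.
  move=> ni' nj'; rewrite lo ?k3 ?e4 //.
  apply: leq_trans (_ : (p * n + i').+1 * n <= _)%N; first by rewrite mulSn addnC ltn_add2r.
  by rewrite leq_mul2r mulSn [(n + _)%N]addnC ltn_add2l ni' orbT.
by rewrite /= s4i s4j s4n s4p !rd.
Qed.

Lemma eq_matrix_ok k q (r r' : nat -> nat -> R) : (forall a x, a != 2 -> r a x = r' a x) ->
  matrix_ok n (loaded_mx n r k q) = matrix_ok n (loaded_mx n r' k q).
Proof.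
move=> rr.
have E : loaded_mx n r k q =2 loaded_mx n r' k q by move=> i j; rewrite /loaded_mx !rr.
have E' p : elim (loaded_mx n r k q) p =2 elim (loaded_mx n r' k q) p.
  by elim: p => //= p IH i j; rewrite /schur !IH.
by apply: eq_all => p; apply: eq_all => j; rewrite /pivot_ok !E'.
Qed.

Lemma one_notin_check_levels k : 1%N \notin nat_writes (check_levels k).
Proof. by elim: k => //= k IH; rewrite mem_cat negb_or IH. Qed.

Lemma runs_check_level s k (b : bool) : nats s 1 0 = n -> nats s 0 0 = b ->
  runs n (check_level k) s (k + 3) (fun f ptr r =>
    [/\ f = b && all (fun q => matrix_ok n (loaded_mx n (rels s) k q)) (iota 0 (n ^ k)),
        ptr = nats s 2 0 & forall a x, a != 2 -> r a x = rels s a x]).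
Proof.
move=> sn sb.
pose J m (f ptr : nat) (r : nat -> nat -> R) := [/\ f = b && all (fun q => matrix_ok n (loaded_mx n (rels s) k q)) (iota 0 m),
        ptr = nats s 2 0 & forall a x, a != 2 -> r a x = rels s a x].
apply: (@runs_for R n _ _ _ s (n ^ k) k 3 J) => //.
- exact: leq_max1_pow.
- by move=> s1 [f1 _]; rewrite neval_pow // f1.
- by split; rewrite ?andbT.
move=> q s1 qn [h1 h2 h3] s1q [f1 _].
have s1n : nats s1 1 0 = n by rewrite f1.
apply: (runs_weak (leqnn _) _ (runs_check_matrix k s1n s1q h1)) => f ptr r [e1 e2 e3].
split; [|by rewrite e2|by move=> a x a2; rewrite e3 // h3].
rewrite e1 all_iota_rcons andbA.
by rewrite (eq_matrix_ok k q h3).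
Qed.

(** The last level dominates: [n ^ (k - 1)] matrices at cost [n ^ 3] each. With [k = d - 1] the
    exponent is [d + 1]. *)
Lemma runs_check_levels s k (b : bool) : nats s 1 0 = n -> nats s 0 0 = b ->
  runs n (check_levels k) s (k + 2) (fun f ptr r =>
    [/\ f = b && all (fun l => all (fun q => matrix_ok n (loaded_mx n (rels s) l q))
                     (iota 0 (n ^ l))) (iota 0 k),
        ptr = nats s 2 0 & forall a x, a != 2 -> r a x = rels s a x]).
Proof.
move=> sn sb; elim: k => [|k IH]; first by apply: runs_skip; split; rewrite // andbT.
have kk : (k + 2 <= k.+1 + 2)%N by lia.
apply: runs_seq; first exact: (runs_weak kk (fun f p r H => H) IH).
move=> s1 [h1 h2 h3] [f1 _].
have s1n : nats s1 1 0 = n.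
  by rewrite f1 // one_notin_check_levels.
have kk' : (k + 3 <= k.+1 + 2)%N by lia.
apply: (runs_weak kk' _ (runs_check_level k s1n h1)) => f ptr r [e1 e2 e3].
split; [|by rewrite e2|by move=> a x a2; rewrite e3 // h3].
rewrite e1 all_iota_rcons andbA; congr (nat_of_bool (_ && _)); apply: eq_all => q.
exact: eq_matrix_ok.
Qed.

End Phases.

(* The digit j of the current word is in natural array 7 + j. *)
Definition NDigit (j : nat) : nexpr := NVar (7 + j).

Definition code_expr (js : seq nat) : nexpr :=
  foldl (fun e j => NIdx e (NDigit j)) (NConst 0) js.

(** By truncated subtraction the inner sum is the distance of the two values, so the result is 1 on
    equal values and 0 otherwise. *)
Definition eq_expr (e1 e2 : nexpr) : nexpr :=
  NSub (NConst 1) (NAdd (NSub e1 e2) (NSub e2 e1)).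

Definition count_expr (j : nat) (pre : seq nat) : nexpr :=
  foldr (fun l e => NAdd (eq_expr (NDigit l) (NDigit j)) e) (NConst 1) pre.

(* Real array 1 converts natural numbers to real numbers. *)
Fixpoint mult_expr (pre js : seq nat) : rexpr :=
  if js is j :: js' then RMul (RGet 1 (count_expr j pre)) (mult_expr (j :: pre) js')
  else RConst 1.

Definition store_next (d : nat) : cmd :=
  Seq (RSet (3 + d) (code_expr (iota 0 d)) (RMul (RGet 0 (NVar 2)) (mult_expr [::] (iota 0 d))))
    (NSet 2 (NConst 0) (NAdd (NVar 2) (NConst 1))).

(* Words are visited in lexicographic order: a sorted word consumes the next
   coefficient; otherwise swapping a descent gives a word visited earlier. *)
Fixpoint store_word (d : nat) (pre js : seq nat) : cmd :=
  match js with
  | a :: ((b :: js'') as js') =>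
      If (BNle (NDigit a) (NDigit b)) (store_word d (a :: pre) js')
        (RSet (3 + d) (code_expr (iota 0 d))
           (RGet (3 + d) (code_expr (rev pre ++ [:: b, a & js'']))))
  | _ => store_next d
  end.

Fixpoint for_words (j k : nat) (c : cmd) : cmd :=
  if k is k'.+1 then For (7 + j) (NVar 1) (for_words j.+1 k' c) else c.

Fixpoint store_casts (k : nat) : cmd :=
  if k is k'.+1 then Seq (store_casts k') (RSet 1 (NConst k) (RConst (Posz k))) else Skip.

(** [check_levels d.-1] covers the word lengths up to [d - 2]; for [d <= 1] it is empty and the
    answer stays 1. *)
Definition decide (d : nat) : cmd :=
  Seq (NSet 1 (NConst 0) (NVar 0)) (Seq (NSet 0 (NConst 0) (NConst 1)) (Seq (store_casts d)
    (Seq (for_words 0 d (store_word d [::] (iota 0 d)))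
      (Seq (fold_levels d) (check_levels d.-1))))).

(** For empty [pre], the product of the factorials of the letter multiplicities of [w]: the factor
    that differentiation along [w] puts on its monomial. *)
Fixpoint mult (T : eqType) (pre w : seq T) : nat :=
  if w is i :: w' then (count_mem i pre).+1 * mult (i :: pre) w' else 1.

Lemma mult_map (T U : eqType) (h : T -> U) pre w : injective h ->
  mult (map h pre) (map h w) = mult pre w.
Proof.
move=> hI; elim: w pre => //= i w IH pre; rewrite -map_cons IH count_map; congr (_.+1 * _)%N.
by apply: eq_count => j /=; rewrite (inj_eq hI).
Qed.

(** * Words in lexicographic order *)

Section Words.
Variable n : nat.

Fixpoint words (d : nat) : seq (seq 'I_n) :=
  if d is d'.+1 then [seq i :: w | i <- enum 'I_n, w <- words d'] else [:: [::]].

Definition sorted_word (w : seq 'I_n) := sorted leq (map val w).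

(** The coefficient of a sorted word thus sits at the number of sorted words before it, and one
    advancing pointer finds them all. *)
Lemma monomial_wordsE d : monomial_words n d = [seq w <- words d | sorted_word w].
Proof.
elim: d => //= d ->; rewrite filter_flatten -map_comp; congr flatten.
apply: eq_map => i /=; rewrite filter_map -filter_predI; congr map; apply: eq_filter => w /=.
rewrite /sorted_word /= path_sortedE; last exact: leq_trans.
by rewrite all_map.
Qed.

Lemma nth_flatten_map (S T : Type) (x0 : T) (y0 : S) (h : S -> seq T) m i q L :
  (forall x, size (h x) = m) -> (q < m)%N -> (i < size L)%N ->
  nth x0 (flatten (map h L)) (i * m + q) = nth x0 (h (nth y0 L i)) q.
Proof.
move=> hm qm; elim: L i => //= x L IH [|i] iL; rewrite nth_cat hm; first by rewrite qm.
by rewrite mulSn -addnA ltnNge leq_addr /= addKn IH.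
Qed.

Lemma size_words d : size (words d) = (n ^ d)%N.
Proof.
elim: d => //= d IH; rewrite size_allpairs IH expnS; congr (_ * _)%N; exact: size_enum_ord.
Qed.

Lemma code_cons i (w : seq 'I_n) : code (i :: w) = (i * n ^ size w + code w)%N.
Proof.
elim/last_ind: w => [|w j IH]; first by rewrite /code /= !addn0 muln1.
by rewrite -rcons_cons !code_rcons IH size_rcons expnSr; ring.
Qed.

Lemma code_cat (u w : seq 'I_n) : code (u ++ w) = (code u * n ^ size w + code w)%N.
Proof.
elim/last_ind: w => [|w j IH]; first by rewrite cats0 /= muln1 addn0.
by rewrite -rcons_cat !code_rcons IH size_rcons expnSr; ring.
Qed.

Lemma nth_words w : nth [::] (words (size w)) (code w) = w.
Proof.
elim: w => //= i w IH; rewrite code_cons.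
rewrite (nth_flatten_map _ i) ?size_enum_ord //; first last.
- exact: code_lt.
- by move=> x; rewrite size_map size_words.
by rewrite nth_ord_enum (nth_map [::]) ?IH // size_words code_lt.
Qed.

Lemma nth_filter_count (T : Type) (x0 : T) (a : pred T) s q :
  (q < size s)%N -> a (nth x0 s q) ->
  nth x0 (filter a s) (count a (take q s)) = nth x0 s q.
Proof.
move=> qs aq; rewrite -{1}(cat_take_drop q s) filter_cat nth_cat size_filter ltnn subnn.
by rewrite (drop_nth x0 qs) /= aq.
Qed.

Lemma code_swap (u w : seq 'I_n) (i j : 'I_n) : (j < i)%N ->
  (code (u ++ [:: j, i & w]) < code (u ++ [:: i, j & w]))%N.
Proof.
move=> ji; rewrite -!(cat_rcons _ _ (_ :: _)) -!cat_rcons !code_cat ltn_add2r.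
rewrite !code_rcons ltn_pmul2r; last by rewrite expn_gt0 (leq_ltn_trans _ (ltn_ord i)).
by have := ltn_ord i; nia.
Qed.

End Words.

(** * Expanding the coefficient list to all words *)

Section Input.
Variables (R : realType) (n : nat).
Implicit Types (s : state R) (w : seq 'I_n) (g : {mpoly R[n]}).

(** [pre] accumulates the exponent: the coefficient of an [i]-derivative at a monomial picks up one
    more than the multiplicity of [i] in it. *)
Lemma wform_coeff g w pre :
  (foldr (@mderiv n R) g w)@_(s2m pre) = g@_(s2m pre + s2m w) *+ mult pre w.
Proof.
elim: w pre => [|i w IH] pre /=.
  by rewrite mulr1n; congr (_@__); apply/mnmP => j; rewrite mnmDE !mnmE addn0.
rewrite mcoeff_deriv.
have -> : (s2m pre + U_(i) = s2m (i :: pre))%MM.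
  by apply/mnmP => j; rewrite mnmDE !mnmE /= addnC.
have -> : s2m pre i = count_mem i pre by rewrite mnmE.
have -> : (s2m pre + s2m (i :: w) = s2m (i :: pre) + s2m w)%MM.
  by apply/mnmP => j; rewrite !mnmDE !mnmE /= addnCA addnA.
by rewrite IH -mulrnA mulnC.
Qed.

Lemma wformE g w : wform g w = g@_(s2m w) *+ mult [::] w.
Proof.
rewrite -[s2m w in RHS]add0m (_ : 0%MM = s2m [::]) -?wform_coeff; last first.
  by apply/mnmP => j; rewrite !mnmE.
by rewrite /wform; congr (_@__); apply/mnmP => j; rewrite !mnmE.
Qed.

Definition digit s j := nats s (7 + j) 0.

Lemma neval_code_expr s js : nats s 1 0 = n ->
  neval s (code_expr js) = foldl (fun q i => q * n + i)%N 0%N (map (digit s) js).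
Proof.
by move=> sn; elim/last_ind: js => //= js j IH; rewrite map_rcons /code_expr -!cats1 !foldl_cat /= -IH sn.
Qed.

Lemma codeE w : foldl (fun q i => q * n + i)%N 0%N (map val w) = code w.
Proof. by rewrite /code; elim: w 0%N => /=. Qed.

Lemma neval_count_expr s j pre :
  neval s (count_expr j pre) = (count_mem (digit s j) (map (digit s) pre)).+1.
Proof.
elim: pre => //= l pre ->; rewrite addnS /digit; congr (_ + _).+1.
by case: eqP => [->|]; lia.
Qed.

Lemma reval_mult_expr s d pre js : (forall j, (j <= d)%N -> rels s 1 j = j%:R) ->
  (size pre + size js <= d)%N ->
  reval s (mult_expr pre js) = (mult (map (digit s) pre) (map (digit s) js))%:R.
Proof.
move=> s1; elim: js pre => //= j js IH pre; rewrite addnS => pd.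
have cd : ((count_mem (digit s j) (map (digit s) pre)).+1 <= d)%N.
  apply: leq_trans pd; rewrite ltnS; apply: leq_trans (count_size _ _) _.
  by rewrite size_map leq_addr.
by rewrite neval_count_expr s1 // IH ?natrM.
Qed.

Lemma runs_store_word s d b Q pre js :
  (sorted leq (map (digit s) js) -> runs n (store_next d) s b Q) ->
  (forall u i j v, rev pre ++ js = u ++ [:: i, j & v] -> (digit s j < digit s i)%N ->
     runs n (RSet (3 + d) (code_expr (iota 0 d))
               (RGet (3 + d) (code_expr (u ++ [:: j, i & v])))) s b Q) ->
  runs n (store_word d pre js) s b Q.
Proof.
elim: js pre => [|i [|j js] IH] pre H1 H2 //=; try exact: H1.
apply: runs_if => /= ij; last first.
  by apply: (H2 (rev pre) i j js) => //; rewrite ltnNge.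
apply: IH => [S|u i' j' v E]; first by apply: H1 => /=; rewrite ij.
by apply: H2; rewrite -E rev_cons cat_rcons.
Qed.

Lemma nat_writes_for_words j l c a : (forall a, a \in nat_writes c -> a \in [:: 0; 2]%N) ->
  a \in nat_writes (for_words j l c) -> a \in [:: 0; 2]%N \/ (7 + j <= a)%N.
Proof.
move=> cw; elim: l j => [|l IHl] j /=; first by move/cw; left.
rewrite inE mem_cat inE => /or3P[/eqP -> | /IHl [|] | /eqP ->]; [by right|by left| |by right].
by rewrite addnS; right; apply: ltnW.
Qed.

(** The extensions of [w0] by [k] letters have consecutive codes, from [code w0 * n ^ k] on, and are
    visited in that order; hence an invariant indexed by the code alone. *)
Lemma runs_for_words (J : nat -> post R) c w0 k s :
  (forall a, a \in nat_writes c -> a \in [:: 0; 2]%N) ->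
  (forall w s1, size w = (size w0 + k)%N -> nats s1 1 0 = n ->
     (forall j, (j < size w)%N -> digit s1 j = nth 0%N (map val w) j) ->
     holds (J (code w)) s1 -> runs n c s1 0 (J (code w).+1)) ->
  nats s 1 0 = n -> (forall j, (j < size w0)%N -> digit s j = nth 0%N (map val w0) j) ->
  holds (J (code w0 * n ^ k)%N) s ->
  runs n (for_words (size w0) k c) s k (J ((code w0).+1 * n ^ k)%N).
Proof.
move=> cw; elim: k w0 s => [|k IH] w0 s hc sn sw Js /=.
  by rewrite muln1; apply: hc; rewrite ?addn0 // -[code w0]muln1.
have W j l a := @nat_writes_for_words j l c a cw.
have lo a : (2 < a < 7 + size w0)%N || (a == 1)%N -> a \notin nat_writes (For (7 + size w0) (NVar 1) (for_words (size w0).+1 k c)).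
  move=> ha; apply/negP => /(W (size w0) k.+1); rewrite !inE => -[]; last by case/orP: ha => [|/eqP ->]; lia.
  by case/orP: ha => [|/eqP -> //]; lia.
pose I i := J ((code w0 * n + i) * n ^ k)%N.
have -> : ((code w0).+1 * n ^ k.+1 = (code w0 * n + n) * n ^ k)%N by rewrite expnS mulSn; ring.
apply: (@runs_for R n _ _ _ s n 1 k I) => //.
- rewrite !inE; apply/negP => /(W (size w0).+1 k); rewrite !inE => -[]; lia.
- by rewrite expn1 leq_maxl.
- by move=> s1 [f1 _] /=; rewrite f1 // lo // orbT.
- by rewrite /I addn0 -mulnA -expnS.
move=> i s1 ni Hi s1i [f1 _].
have e : code (rcons w0 (Ordinal ni)) = (code w0 * n + i)%N by rewrite code_rcons.
rewrite /I addnS -e -(size_rcons w0 (Ordinal ni)); apply: IH => //.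
- by move=> w s2; rewrite size_rcons addSnnS; apply: hc.
- by rewrite f1 // lo // orbT.
- move=> j; rewrite size_rcons ltnS map_rcons nth_rcons size_map leq_eqVlt.
  case/orP=> [/eqP ->|jw]; first by rewrite ltnn eqxx.
  by rewrite jw -sw // /digit f1 // lo // ltn_add2l jw.
- by rewrite e.
Qed.

Lemma runs_store_casts s k : runs n (store_casts k) s 0 (fun f p r =>
  [/\ f = nats s 0 0, p = nats s 2 0, forall a x, a != 1%N -> r a x = rels s a x,
      r 1%N 0%N = rels s 1 0 & forall j, (0 < j <= k)%N -> r 1%N j = j%:R]).
Proof.
elim: k => [|k IH] /=; first by apply: runs_skip; split=> // -[].
apply: runs_seq IH _ => s1 [h1 h2 h3 h4 h5] _; apply: runs_rset; split=> //.
- by move=> a x a1; rewrite update_array ?h3.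
- move=> j /andP[j0]; rewrite leq_eqVlt => /orP[/eqP ->|jk]; first by rewrite update_same.
  by rewrite update_cell ?h5 ?j0 // ltn_eqF.
Qed.

Lemma nat_writes_store_word d pre js a :
  a \in nat_writes (store_word d pre js) -> a \in [:: 0; 2]%N.
Proof.
elim: js pre => [|i [|j js] IH] pre /=; try by rewrite !inE => /eqP ->.
by rewrite cats0; apply: IH.
Qed.

Lemma runs_load d g s : nats s 1 0 = n -> nats s 2 0 = 0%N ->
  (forall x, rels s 0 x = nth 0 (coeff_list d g) x) ->
  (forall j, (j <= d)%N -> rels s 1 j = j%:R) ->
  runs n (for_words 0 d (store_word d [::] (iota 0 d))) s d (fun f p r =>
    f = nats s 0 0 /\ forall w, size w = d -> r (3 + d)%N (code w) = wform g w).
Proof.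
move=> sn sp s0 s1.
pose J q (f p : nat) (r : nat -> nat -> R) :=
  [/\ f = nats s 0 0, p = count (@sorted_word n) (take q (words n d)),
      forall a x, (a < 2)%N -> r a x = rels s a x &
      forall w, size w = d -> (code w < q)%N -> r (3 + d)%N (code w) = wform g w].
apply: (@runs_weak R n _ _ d _ (J ((@code n [::]).+1 * n ^ d)%N)) => // [f p r [-> _ _ H]|].
  by split=> // w wd; apply: H => //; rewrite mul1n -wd code_lt.
apply: (@runs_for_words J _ [::] d s) => //.
- exact: nat_writes_store_word.
- move=> w s2; rewrite add0n => wd s2n s2w [h1 h2 h3 h4].
  have dE : map (digit s2) (iota 0 d) = map val w.
    apply: (@eq_from_nth _ 0%N) => [|j]; rewrite !size_map size_iota ?wd // => jd.
    by rewrite (nth_map 0%N) ?size_iota // nth_iota // s2w ?wd.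
  have wq : nth [::] (words n d) (code w) = w by rewrite -wd nth_words.
  have qd : (code w < size (words n d))%N by rewrite size_words -wd code_lt.
  have cE : neval s2 (code_expr (iota 0 d)) = code w by rewrite neval_code_expr // dE codeE.
  have cnt : count (@sorted_word n) (take (code w).+1 (words n d)) =
      (count (@sorted_word n) (take (code w) (words n d)) + sorted_word w)%N.
    by rewrite (take_nth [::]) // wq -cats1 count_cat /= addn0.
  apply: runs_store_word; [rewrite dE|].
    move=> ws; have pE : nth 0 (coeff_list d g) (nats s2 2 0) = g@_(s2m w).
      rewrite /coeff_list monomial_wordsE h2 (nth_map [::]).
        by rewrite nth_filter_count // wq.
      rewrite size_filter -[in X in (_ < X)%N](cat_take_drop (code w) (words n d)) count_cat.
      by rewrite (drop_nth [::] qd) /= wq /sorted_word ws; lia.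
    apply: (@runs_seq R n _ _ _ _ (fun f p r => [/\ f = nats s 0 0, p = nats s2 2 0,
      forall a x, (a < 2)%N -> r a x = rels s a x &
      forall w', size w' = d -> (code w' < (code w).+1)%N -> r (3 + d)%N (code w') = wform g w'])).
      apply: runs_rset; split=> //.
      + by move=> a x a2; rewrite update_array ?h3 // ltn_eqF // (leq_trans a2).
      + move=> w' w'd; rewrite ltnS leq_eqVlt cE => /orP[/eqP e|lt]; last first.
          by rewrite update_cell ?h4 // ltn_eqF.
        rewrite e update_same /= h3 // s0 pE (@reval_mult_expr _ d) ?size_iota //; last first.
          by move=> j jd; rewrite h3 ?s1.
        have -> : w' = w by rewrite -(nth_words w') -(nth_words w) w'd wd e.
        by rewrite dE (mult_map [::] _ val_inj) wformE mulr_natr.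
    move=> s3 [k1 k2 k3 k4] _; apply: runs_nset; split=> //.
    by rewrite [nats _ _ _]/= update_same /= k2 cnt h2 /sorted_word ws.
  move=> u i j v iE ij; apply: runs_rset.
  have {}iE : iota 0 d = u ++ [:: i, j & v] := iE.
  have lt x : x \in u ++ [:: i, j & v] -> (x < d)%N by rewrite -iE mem_iota.
  have im : i \in u ++ [:: i, j & v] by rewrite mem_cat !inE eqxx orbT.
  have jm : j \in u ++ [:: i, j & v] by rewrite mem_cat !inE eqxx !orbT.
  have id' := lt i im.
  (* The descent shows that [w] is nonempty, which supplies the default letter for [nth]. *)
  have [i0 _] : exists i0 : 'I_n, i0 \in w.
    by case: (w) wd => [wd|i0 w' _]; [rewrite -wd in id'|exists i0; rewrite mem_head].
  pose D := nth i0 w.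
  have DE x : x \in u ++ [:: i, j & v] -> digit s2 x = D x.
    by move=> /lt xd; rewrite s2w ?wd // (nth_map i0) ?wd.
  have wE : w = map D u ++ [:: D i, D j & map D v].
    by have := map_nth_iota0 i0 (leqnn (size w)); rewrite take_size wd iE map_cat /= => ->.
  pose w' := map D u ++ [:: D j, D i & map D v].
  have ww' : perm_eq w' w.
    by rewrite wE perm_cat2l -[[:: D j, D i & _]]/([:: D j] ++ [:: D i] ++ map D v) perm_catCA.
  have w'd : size w' = d by rewrite (perm_size ww').
  have cE' : neval s2 (code_expr (u ++ [:: j, i & v])) = code w'.
    rewrite neval_code_expr // -codeE; congr foldl.
    have -> : w' = map D (u ++ [:: j, i & v]) by rewrite map_cat.
    rewrite -map_comp; apply/eq_in_map => x xin; apply: DE.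
    by move: xin; rewrite !mem_cat !inE [(x == j) || _]orbCA.
  have ltc : (code w' < code w)%N.
    by rewrite wE; apply: code_swap; rewrite -(DE i im) -(DE j jm).
  (* An unsorted word leaves the pointer in place. *)
  have nsw : sorted_word w = false.
    apply/negP; rewrite /sorted_word wE map_cat => /cat_sorted2[_] /= /andP[].
    by rewrite -[(val (D i))](DE i im) -[(val (D j))](DE j jm) leqNgt ij.
  split=> //.
  + by rewrite cnt nsw addn0.
  + by move=> a x a2; rewrite update_array ?h3 // ltn_eqF // (leq_trans a2).
  + move=> x xd; rewrite ltnS leq_eqVlt cE => /orP[/eqP e|ltx]; last first.
      by rewrite update_cell ?h4 // ltn_eqF.
    rewrite e update_same /= cE' h4 //.
    have -> : x = w by rewrite -(nth_words x) -(nth_words w) xd wd e.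
    exact: symw_wform.
- by rewrite mul0n; split=> //; rewrite take0.
Qed.

End Input.

(** * Correctness of the decision program *)

Section Correctness.
Variables (R : realType) (n : nat).
Implicit Types (s : state R) (g : {mpoly R[n]}).

(** [runs_seq] passes on only what [post] and the frame see; here the exact state is kept, so that
    the copy of [n] in array 1 is known afterwards. *)
Lemma runs_nset_seq a e v c s b (Q : post R) :
  runs n c (State (update (nats s) a (neval s e) (neval s v)) (rels s)) b Q ->
  runs n (Seq (NSet a e v) c) s b Q.
Proof.
move=> [t [s' [E T H]]]; exists ((ncost e + ncost v).+1 + t)%N, s'; split=> //.
  by apply: exec_seq E; apply: exec_nset.
by rewrite /= mulnDl leq_add // leq_pmulr // expn_max_gt0.
Qed.

Lemma eq_elim (M M' : nat -> nat -> R) p :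
  (forall i j, (i < n)%N -> (j < n)%N -> M i j = M' i j) -> (p <= n)%N ->
  forall i j, (i < n)%N -> (j < n)%N -> elim M p i j = elim M' p i j.
Proof.
move=> MM; elim: p => //= p IH pn i j ni nj; have h := IH (ltnW pn).
by rewrite /schur !h.
Qed.

Lemma matrix_okP (M : nat -> nat -> R) :
  reflect (forall p j, (p < n)%N -> (j < n)%N -> pivot_ok (elim M p) p j) (matrix_ok n M).
Proof.
apply: (iffP allP) => H p; last by rewrite mem_iota => pn; apply/allP => j; rewrite mem_iota => jn; apply: H.
move=> j pn jn; have /allP : all (pivot_ok (elim M p) p) (iota 0 n) by apply: H; rewrite mem_iota.
by apply; rewrite mem_iota.
Qed.

Lemma eq_in_matrix_ok (M M' : nat -> nat -> R) :
  (forall i j, (i < n)%N -> (j < n)%N -> M i j = M' i j) -> matrix_ok n M = matrix_ok n M'.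
Proof.
move=> MM; apply: eq_in_all => p; rewrite mem_iota => pn; apply: eq_in_all => j; rewrite mem_iota => jn.
by rewrite /pivot_ok !(eq_elim MM (ltnW pn)).
Qed.

Lemma runs_decide d g : runs n (decide d) (input n (coeff_list d g)) d.+1 (fun f p r =>
  exists2 G : nat -> R, forall w, size w = d -> G (code w) = wform g w &
    f = all (fun l => all (fun q => matrix_ok n (test_mx n d G l q)) (iota 0 (n ^ l)))
          (iota 0 d.-1)).
Proof.
apply: runs_nset_seq; apply: runs_nset_seq; set s1 := State _ _.
have s1n : nats s1 1 0 = n by [].
apply: runs_seq; first exact: (runs_weak (leq0n _) (fun f p r H => H) (runs_store_casts n s1 d)).
move=> s2 [a1 a2 a3 a4 a5] [f2 _].
have s2n : nats s2 1 0 = n by rewrite f2 //; elim: (d) => //= k; rewrite cats0.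
apply: runs_seq.
  apply: (runs_weak (leqnSn d) (fun f p r H => H)); apply: (@runs_load _ _ d g) => //.
  - by move=> x; rewrite a3.
  - by case=> [_|j jd]; rewrite ?a4 ?a5.
move=> s3 [b1 b2] [f3 _].
have s3n : nats s3 1 0 = n.
  rewrite f3 //; apply/negP => /nat_writes_for_words [| |//] //.
  exact: nat_writes_store_word.
set G := rels s3 (3 + d)%N in b2.
apply: runs_seq.
  apply: (runs_weak (leqnSn d) (fun f p r H => H)); apply: (@runs_fold_levels _ _ d) => // l q.
  by rewrite -eqn_leq => /eqP <- _; rewrite /table subnn.
move=> s4 [c1 c2 c3] [f4 _].
have s4n : nats s4 1 0 = n.
  by rewrite f4 //; elim: (d) => //= k IH; rewrite !inE mem_cat negb_or IH.
have s4b : nats s4 0 0 = true by rewrite c1 b1 a1.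
have [t [s' [E T [H1 H2 H3]]]] : runs n (check_levels d.-1) s4 d.+1 (fun f ptr r =>
    [/\ f = true && all (fun l => all (fun q => matrix_ok n (loaded_mx n (rels s4) l q))
                     (iota 0 (n ^ l))) (iota 0 d.-1),
        ptr = nats s4 2 0 & forall a x, a != 2 -> r a x = rels s4 a x]).
  case: (d) => [|k]; first by apply: runs_skip; split=> //; rewrite s4b.
  by apply: (runs_weak _ (fun f p r H => H) (runs_check_levels k s4n s4b)); rewrite /= addn2.
exists t, s'; split=> //; exists G => //; rewrite H1 /=; congr nat_of_bool.
apply: eq_in_all => l; rewrite mem_iota add0n => /= ld.
apply: eq_in_all => q; rewrite mem_iota add0n => /= qn.
apply: eq_in_matrix_ok => i j ni nj; rewrite /loaded_mx /test_mx -!/(3 + _)%N.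
have lt m x y : (x < n ^ m)%N -> (y < n)%N -> (x * n + y < n ^ m.+1)%N.
  move=> xm yn; rewrite expnSr; apply: leq_trans (_ : x.+1 * n <= _)%N.
    by rewrite mulSn addnC ltn_add2r.
  by rewrite leq_mul2r xm orbT.
have qi := lt _ _ _ qn ni; have qj := lt _ _ _ qn nj; have qij := lt _ _ _ qi nj.
have [l0 l1 l2] : [/\ l <= d, l.+1 <= d & l.+2 <= d]%N by split; lia.
by rewrite (c3 l.+1 _ l1 qi) (c3 l.+1 _ l1 qj) (c3 l _ l0 qn) (c3 l.+2 _ l2 qij).
Qed.

End Correctness.

Theorem proposition4p2 (R : realType) (d : nat) :
  exists (P : cmd) (C : nat),
    forall (n : nat) (f : {mpoly R[n]}),
      f \is d.-homog ->
      (forall m, 0 <= f@_m) ->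
      exists (t : nat) (s : state R),
        exec P (input n (coeff_list d f)) t s
        /\ (accepts s <-> completely_log_concave f)
        /\ ((0 < n)%N -> (t <= C * n ^ d.+1)%N).
Proof.
exists (decide d), (cost_const (decide d)) => n f hf f0.
have [t [s [E T [G GF fl]]]] := runs_decide d f.
exists t, s; split=> //; split; last by move=> n0; rewrite (maxn_idPl n0) in T.
rewrite /accepts fl.
(* For [d <= 1] the program always accepts, rightly so, since the inequality required by [af_clc] is
   then vacuous. *)
have [d2|d2] := ltnP 1 d; last first.
  have -> : d.-1 = 0%N by lia.
  by split=> // _; apply: (af_clc hf) => //; lia.
rewrite (clc_criterion hf f0 d2).
rewrite (local_lorentz_table (@symw_wform _ _ f) (wform_ge0 f0) GF d2).
set b := all _ _; have -> : (nat_of_bool b <> 0%N) <-> b by case: b.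
split=> [/allP H k q p j kd qn pn jn|H].
  have /allP Hk : all (fun q => matrix_ok n (test_mx n d G k q)) (iota 0 (n ^ k)).
    by apply: H; rewrite mem_iota; lia.
  have /matrix_okP Hq : matrix_ok n (test_mx n d G k q) by apply: Hk; rewrite mem_iota.
  exact: Hq.
apply/allP => k; rewrite mem_iota => kd; apply/allP => q; rewrite mem_iota => qn.
by apply/matrix_okP => p j pn jn; apply: H => //; lia.
Qed.
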